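(* Let $\Omega\subset\mathbb{R}^2\simeq\mathbb{C}$ be a domain, and let $L$ be a continuously differentiable real-valued function $(t,y,z)\mapsto L(t,y,z)$ of $t=(t^1,t^2)\in\Omega$, $y=(y^j)_{1\le j\le n}\in\mathbb{R}^n$ and $z=(z^j_\alpha)_{1\le j\le n,\ \alpha=1,2}\in M(\mathbb{R}^2,\mathbb{R}^n)$ (real $n\times 2$ matrices). The action $$\mathcal{L}[u]=\int_\Omega L(t,u(t),du(t))\,dt^1dt^2,\qquad u:\Omega\to\mathbb{R}^n,$$ is invariant by conformal transformations if and only if $$L(t,y^j,z^j_\alpha)=F(y^j,z^j_1+iz^j_2)\quad\text{for all }(t,y,z),$$ where $F:\mathbb{R}^n\times\mathbb{C}^n\to\mathbb{R}$ satisfies $$F(y,\lambda z)=|\lambda|^2F(y,z)\qquad\text{for all }\lambda\in\mathbb{C},\ y\in\mathbb{R}^n,\ z\in\mathbb{C}^n.$$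
   Context: For $u:\Omega\to\mathbb{R}^n$ the argument $z^j_\alpha$ of $L$ is filled with $\partial u^j/\partial t^\alpha$, $j=1,\dots,n$, $\alpha=1,2$. For a subdomain $\omega$, write $\mathcal{L}_\omega[u]=\int_\omega L(t,u(t),du(t))\,dt^1dt^2$. Let $X$ be a vector field defined on an open subset of $\mathbb{R}^2$ containing the closure of $\Omega$, with local flow $\Psi_s$, so that $\Psi_s(t)=t+sX(t)+o(s)$. For a ($C^1$) map $u:\Omega\to\mathbb{R}^n$, define $u_s$ on $\Psi_s(\Omega)$ by $u_s\circ\Psi_s=u$ (the graph of $u_s$ is the image of the graph of $u$ under $(t,y)\mapsto(\Psi_s(t),y)$). The action $\mathcal{L}$ is invariant by $X$ if for every subdomain $\omega\subset\Omega$ and every map $u$, one has $\mathcal{L}_{\Psi_s(\omega)}[u_s]=\mathcal{L}_\omega[u]$ for all $s$ for which both sides make sense; here this means: $\omega$ is relatively compact in $\Omega$, and $s$ is small enough that $\Psi_{s'}(\omega)$ is defined and relatively compact in $\Omega$ for all $s'$ between $0$ and $s$. The action $\mathcal{L}$ is invariant by conformal transformations if it is invariant by every such $X$ whose flow maps $\Psi_s$ are holomorphic, i.e. by every $X=(X^1,X^2)$ satisfying the Cauchy-Riemann equations $\partial_{t^1}X^1-\partial_{t^2}X^2=\partial_{t^2}X^1+\partial_{t^1}X^2=0$ (this includes constant vector fields, generating translations). *)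

(* Defs.v *)
From HB Require Import structures.
From mathcomp Require Import all_boot all_order all_algebra.
From mathcomp Require Import complex.
From mathcomp Require Import all_classical all_reals all_analysis.

Set Implicit Arguments.
Unset Strict Implicit.
Unset Printing Implicit Defensive.

Import Order.TTheory GRing.Theory Num.Theory.
Import numFieldNormedType.Exports.

Local Open Scope classical_set_scope.
Local Open Scope ring_scope.

Definition domain (T : topologicalType) (A : set T) : Prop :=
  [/\ open A, A !=set0 & connected A].

Definition relatively_compact_in (T : topologicalType) (A B : set T) : Prop :=
  compact (closure A) /\ closure A `<=` B.

(* Meant for A open and V finite-dimensional: continuity of every directional
   derivative is then continuity of the differential. *)
Definition C1_on (R : realType) (V W : normedModType R) (A : set V)
    (f : V -> W) : Prop :=
  (forall x, A x -> differentiable f x) /\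
  (forall v x, A x -> {for x, continuous (fun p => 'D_v f p)}).

Section Plane.
Variable R : realType.

(* basis_vec 0 and basis_vec 1 are the directions of t^1 and t^2. *)
Definition basis_vec (a : 'I_2) : R * R := if a == 0 then (1, 0) else (0, 1).

Definition partial (a : 'I_2) (f : R * R -> R) (t : R * R) : R :=
  'D_(basis_vec a) f t.

Definition du (n : nat) (u : R * R -> 'cV[R]_n) (t : R * R) : 'M[R]_(n, 2) :=
  \matrix_(j < n, a < 2) partial a (fun t' => u t' j 0) t.

Definition action (n : nat) (L : R * R -> 'cV[R]_n -> 'M[R]_(n, 2) -> R)
    (w : set (R * R)) (u : R * R -> 'cV[R]_n) : R :=
  (\int[(lebesgue_measure \x lebesgue_measure)%E]_(t in w)
     L t (u t) (du u t))%R.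

Definition integral_curve (U : set (R * R)) (X : R * R -> R * R)
    (a b : R) (g : R -> R * R) : Prop :=
  forall r, a < r < b -> U (g r) /\ is_derive r (1 : R) g (X (g r)).

(* The local flow is a partial map: flow_rel U X s t p says that the integral
   curve issued from t stays in U up to time s, where it is at p. *)
Definition flow_rel (U : set (R * R)) (X : R * R -> R * R) (s : R)
    (t p : R * R) : Prop :=
  exists (a b : R) (g : R -> R * R),
    [/\ a < 0 < b, a < s < b, integral_curve U X a b g, g 0 = t & g s = p].

Definition flow_defined (U : set (R * R)) (X : R * R -> R * R) (s : R)
    (t : R * R) : Prop :=
  exists p, flow_rel U X s t p.

(* Where the flow is not defined, the value is the irrelevant default t. *)
Definition flow (U : set (R * R)) (X : R * R -> R * R) (s : R)
    (t : R * R) : R * R :=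
  xget t [set p | flow_rel U X s t p].

Definition action_invariant_by (n : nat) (Omega : set (R * R))
    (L : R * R -> 'cV[R]_n -> 'M[R]_(n, 2) -> R)
    (U : set (R * R)) (X : R * R -> R * R) : Prop :=
  forall (w : set (R * R)) (u : R * R -> 'cV[R]_n) (s : R)
         (us : R * R -> 'cV[R]_n),
    domain w -> relatively_compact_in w Omega ->
    C1_on Omega u ->
    (forall s', Num.min 0 s <= s' <= Num.max 0 s ->
       (forall t, w t -> flow_defined U X s' t) /\
       relatively_compact_in (flow U X s' @` w) Omega) ->
    (forall t, Omega t -> flow_defined U X s t -> us (flow U X s t) = u t) ->
    action L (flow U X s @` w) us = action L w u.

Definition cauchy_riemann_on (U : set (R * R)) (X : R * R -> R * R) : Prop :=
  forall t, U t ->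
    partial 0 (fun p => (X p).1) t - partial 1 (fun p => (X p).2) t = 0 /\
    partial 1 (fun p => (X p).1) t + partial 0 (fun p => (X p).2) t = 0.

Definition conformally_invariant (n : nat) (Omega : set (R * R))
    (L : R * R -> 'cV[R]_n -> 'M[R]_(n, 2) -> R) : Prop :=
  forall (U : set (R * R)) (X : R * R -> R * R),
    open U -> closure Omega `<=` U ->
    C1_on U X -> cauchy_riemann_on U X ->
    action_invariant_by Omega L U X.

Definition complexify (n : nat) (z : 'M[R]_(n, 2)) : 'cV[R[i]]_n :=
  \col_(j < n) (z j 0 +i* z j 1)%C.

End Plane.

(* Main.v *)
Require Import Defs.
From HB Require Import structures.
From mathcomp Require Import all_boot all_order all_algebra.
From mathcomp Require Import complex.
From mathcomp Require Import ring lra.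
From mathcomp Require Import all_classical all_reals all_analysis.
From mathcomp Require Import measurable_realfun.

Set Implicit Arguments.
Unset Strict Implicit.
Unset Printing Implicit Defensive.

Import Order.TTheory GRing.Theory Num.Theory.
Import numFieldNormedType.Exports.

Local Open Scope classical_set_scope.
Local Open Scope ring_scope.

(** The plane is R * R with the sup norm, seen as the complex line through the
product [cmul]; the map z |-> complexify z of the integrand turns composition of
u with a complex affine change of variable t |-> b t into multiplication of
complexify (du u) by the conjugate of b ([complexify_du_comp]).

If L is F with F (y, lambda z) = |lambda|^2 F (y, z), invariance is a change of
variables.  A vector field satisfying the Cauchy-Riemann equations is
holomorphic, hence its flow at time s is an injective map with a nonzero complex
derivative c ([flow_conformal]); at the image point the complexified derivative
of us is that of u divided by the conjugate of c, so the integrand gets the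
factor 1 / |c|^2, which is exactly the inverse of the Jacobian
([Rintegral_change_of_variables]).

Conversely, the affine fields v + mu (t - t0) have explicit flows.  Applying
invariance to affine maps u and to smaller and smaller squares around t0 gives a
pointwise identity ([affine_flow_identity]).  Constant fields make L locally
constant in t, hence constant on the connected set Omega
([invariant_constant]); the flows of fields vanishing at t0 fix t0 and multiply z
by an arbitrary nonzero complex number ([invariant_scaling]).

The analysis rests on one notion, strict complex differentiability
[strict_cdiff].  It follows for holomorphic fields from the mean value theorem,
it passes to flows by a Gronwall estimate, it yields the inverse function
theorem by minimising a distance, and it compares the image of a small square
with a similar square, which gives the change of variables formula in the plane
without general Jacobians. *)

(** * The complex line R * R *)

Section Plane.
Variable R : realType.

Notation C := (R * R)%type.

Implicit Types (p q c z : C).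

Definition cmul (p q : C) : C := (p.1 * q.1 - p.2 * q.2, p.1 * q.2 + p.2 * q.1).

Definition sqn (p : C) : R := p.1 ^+ 2 + p.2 ^+ 2.

Definition cinv (p : C) : C := (p.1 / sqn p, - p.2 / sqn p).

Lemma sqn_ge0 p : 0 <= sqn p.
Proof. by rewrite /sqn addr_ge0 // sqr_ge0. Qed.

Lemma sqn_eq0 p : (sqn p == 0) = (p == 0).
Proof. case: p => a b; rewrite /sqn/= paddr_eq0 ?sqr_ge0// !sqrf_eq0. by []. Qed.

Lemma sqn_gt0 p : p != 0 -> 0 < sqn p.
Proof. by move=> p0; rewrite lt_neqAle sqn_ge0 eq_sym sqn_eq0 p0. Qed.

Lemma sqn_cmul p q : sqn (cmul p q) = sqn p * sqn q.
Proof. rewrite /sqn /cmul/=; ring. Qed.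

Lemma cmulA p q z : cmul p (cmul q z) = cmul (cmul p q) z.
Proof. rewrite /cmul/=; congr pair; ring. Qed.

Lemma cmulC p q : cmul p q = cmul q p.
Proof. rewrite /cmul/=; congr pair; ring. Qed.

Lemma cmul1 p : cmul (1, 0) p = p.
Proof. case: p => a b; rewrite /cmul/=; congr pair; ring. Qed.

Lemma cmulV p : p != 0 -> cmul p (cinv p) = (1, 0).
Proof.
move=> p0; have := sqn_gt0 p0; rewrite lt_neqAle eq_sym => /andP[h _].
rewrite /cmul /cinv/=; congr pair; last by ring.
have <- : sqn p / sqn p = 1 by rewrite divff.
rewrite {3}/sqn; ring.
Qed.

Lemma cmulKV p q : p != 0 -> cmul p (cmul (cinv p) q) = q.
Proof. by move=> p0; rewrite cmulA cmulV// cmul1. Qed.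

Lemma cmulVK p q : p != 0 -> cmul (cinv p) (cmul p q) = q.
Proof. by move=> p0; rewrite cmulA (cmulC (cinv p)) cmulV// cmul1. Qed.

Lemma cmulDr c p q : cmul c (p + q) = cmul c p + cmul c q.
Proof. rewrite /cmul/= ; congr pair; rewrite /=; ring. Qed.

Lemma cmulBr c p q : cmul c (p - q) = cmul c p - cmul c q.
Proof. rewrite /cmul/= ; congr pair; rewrite /=; ring. Qed.

Lemma cmulBl c p q : cmul (p - q) c = cmul p c - cmul q c.
Proof. rewrite /cmul/= ; congr pair; rewrite /=; ring. Qed.

Lemma scale_pair (a : R) p : a *: p = (a * p.1, a * p.2).
Proof. by []. Qed.

Lemma cmulZr c (a : R) p : cmul c (a *: p) = a *: cmul c p.
Proof. rewrite !scale_pair /cmul/=; congr pair; ring. Qed.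

Lemma pair_ext p q : p.1 = q.1 -> p.2 = q.2 -> p = q.
Proof. by case: p q => [a b] [a' b'] /= -> ->. Qed.

Lemma cmul0 c : cmul c 0 = 0.
Proof. by rewrite /cmul/= !mulr0 subrr addr0. Qed.

Lemma sqn_cinv p : p != 0 -> sqn (cinv p) = (sqn p)^-1.
Proof.
move=> p0; have := sqn_gt0 p0; rewrite lt_neqAle eq_sym => /andP[h _].
rewrite {1}/sqn/cinv/=. rewrite !expr_div_n sqrrN -mulrDl -/(sqn p). by field.
Qed.

Lemma cinv_neq0 p : p != 0 -> cinv p != 0.
Proof. by move=> p0; rewrite -sqn_eq0 sqn_cinv// invr_eq0 sqn_eq0. Qed.

Lemma norm_le p (e : R) : (`|p| <= e) = (`|p.1| <= e) && (`|p.2| <= e).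
Proof. by rewrite /Num.norm/= ge_max. Qed.

Lemma norm_lt p (e : R) : (`|p| < e) = (`|p.1| < e) && (`|p.2| < e).
Proof. by rewrite /Num.norm/= gt_max. Qed.

Lemma norm1_le p : `|p.1| <= `|p|.
Proof. by have := lexx `|p|; rewrite norm_le => /andP[]. Qed.

Lemma norm2_le p : `|p.2| <= `|p|.
Proof. by have := lexx `|p|; rewrite norm_le => /andP[]. Qed.

Lemma norm_cmul p q : `|cmul p q| <= 2 * `|p| * `|q|.
Proof.
have h a b : `|a| <= `|p| -> `|b| <= `|q| -> `|a * b| <= `|p| * `|q|.
  by move=> ha hb; rewrite normrM ler_pM.
rewrite norm_le /cmul/=; apply/andP; split; rewrite -mulrA mulr_natl mulr2n.
- by apply: (le_trans (ler_normB _ _)); apply: lerD; apply: h; rewrite ?norm1_le ?norm2_le.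
- by apply: (le_trans (ler_normD _ _)); apply: lerD; apply: h; rewrite ?norm1_le ?norm2_le.
Qed.

Lemma norm_sqn p : `|p| ^+ 2 <= sqn p.
Proof.
have -> : `|p| = Num.max `|p.1| `|p.2| by [].
rewrite /sqn maxEle; case: ifP => _; rewrite -normrX ger0_norm ?sqr_ge0//.
- by rewrite lerDr sqr_ge0.
- by rewrite lerDl sqr_ge0.
Qed.

Lemma sqn_norm p : sqn p <= 2 * `|p| ^+ 2.
Proof.
have h a : `|a| <= `|p| -> a ^+ 2 <= `|p| ^+ 2.
  by move=> ha; rewrite -[a ^+ 2]ger0_norm ?sqr_ge0// normrX lerXn2r// nnegrE.
by rewrite mulr_natl mulr2n lerD// h// ?norm1_le ?norm2_le.
Qed.

Local Notation leb := (@lebesgue_measure R).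
Local Notation leb2 := (leb \x leb)%E.
Local Notation mR := (measurableTypeR R).
Local Notation push_measure := measure_function_pushforward__canonical__measure_function_Measure.

Lemma measurable_affine (a b : R) : measurable_fun [set: mR] (fun y : mR => a * y + b : mR).
Proof.
by apply: measurable_funD => //; apply: measurable_funM => //; exact: measurable_cst.
Qed.

(** Both sides are measures in A that agree on half-open intervals. *)
Lemma lebesgue_affine (a b : R) (A : set (mR)) : a != 0 -> measurable A ->
  leb A = (`|a|%:E * leb ((fun y => a * y + b)%R @^-1` A))%E.
Proof.
move=> a0 mA.
pose nu : {measure set (mR) -> \bar R} := push_measure leb (measurable_affine a b).
pose mu : {measure set (mR) -> \bar R} := mscale (NngNum (normr_ge0 a)) nu.
rewrite (@lebesgue_measure_unique _ mu) //= => _ [[x y]] _ <-.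
have -> : mu `]x, y]%classic = (`|a|%:E * leb ((fun y => a * y + b)%R @^-1` `]x,
  y]%classic))%E by [].
rewrite lebesgue_measure_itv/=.
have [a1|a1] : 0 < a \/ a < 0 by move: a0; rewrite neq_lt => /orP[]; [right|left].
- have -> : (fun y0 : R => (a * y0 + b)) @^-1` `]x, y] = `](x - b) / a, (y - b) / a]%classic.
    by apply/seteqP; split => z /=; rewrite !in_itv/= ltr_pdivrMr// ler_pdivlMr// mulrC ltrBlDr
      lerBrDr.
  rewrite lebesgue_measure_itv/= !lte_fin gtr0_norm// ltr_pM2r ?invr_gt0// ltrD2r.
  case: ifP => _; last by rewrite mule0.
  rewrite -EFinM; congr EFin; field; exact: lt0r_neq0.
- have -> : (fun y0 : R => (a * y0 + b)) @^-1` `]x, y] = `[(y - b) / a, (x - b) / a[%classic.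
    apply/seteqP; split => z /=; rewrite !in_itv/= ltr_ndivlMr// ler_ndivrMr// mulrC ltrBlDr
      lerBrDr; by rewrite andbC.
  rewrite lebesgue_measure_itv/= !lte_fin ltr0_norm// ltr_nM2r ?invr_lt0// ltrD2r.
  case: ifP => _; last by rewrite mule0.
  rewrite -EFinM; congr EFin; field; exact: ltr0_neq0.
Qed.

(** * Similarities and planar Lebesgue measure *)

(** Stated with preimages, which compose without mentioning an inverse of f;
for a linear map f, k is |det f|. *)
Definition scales_area (f : C -> C) (k : R) := measurable_fun [set: mR * mR] (f : mR * mR ->
  mR * mR) /\
  (forall A : set (mR * mR), measurable A -> leb2 A = (k%:E * leb2 (f @^-1` A))%E).

Lemma scales_area_comp f g k l : scales_area f k -> scales_area g l -> scales_area (g \o f) (l * k).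
Proof.
move=> [mf fk] [mg gl]; split; first exact: measurableT_comp.
move=> A mA; rewrite gl//. rewrite [in LHS]fk; first by rewrite EFinM muleA.
by rewrite -[X in measurable X]setTI; exact: mg.
Qed.

(** Uniqueness of the product measure reduces the property to rectangles. *)
Lemma scales_area_rect f (k : R) : 0 <= k -> measurable_fun [set: mR * mR] (f : mR * mR ->
  mR * mR) ->
  (forall A B : set (mR), measurable A -> measurable B ->
   (k%:E * leb2 (f @^-1` (A `*` B)) = leb A * leb B)%E) -> scales_area f k.
Proof.
move=> k0 mf h; split => // A mA.
pose nu : {measure set (mR * mR) -> \bar R} := push_measure leb2 mf.
pose mu : {measure set (mR * mR) -> \bar R} := mscale (NngNum k0) nu.
by rewrite (@product_measure_unique _ _ _ _ _ leb leb mu).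
Qed.

Lemma scales_area_diag (a b : R) : a != 0 -> b != 0 -> scales_area (fun p => (a * p.1, b * p.2))
  (`|a| * `|b|).
Proof.
move=> a0 b0; apply: scales_area_rect => //.
  by apply: measurable_fun_pair; apply: measurable_funM => //; exact: measurable_cst.
move=> A B mA mB.
have mpre (c : R) (D : set (mR)) : measurable D -> measurable ((fun y : mR => c * y + 0
  : mR) @^-1` D).
  by move=> mD; rewrite -[X in measurable X]setTI; exact: measurable_affine.
have -> : (fun p : C => (a * p.1, b * p.2)) @^-1` (A `*` B) = ((fun y =>
  a * y + 0) @^-1` A) `*` ((fun y => b * y + 0) @^-1` B).
  by apply/seteqP; split => -[x y] /=; rewrite /= !addr0.
rewrite (lebesgue_affine 0 a0 mA) (lebesgue_affine 0 b0 mB).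
rewrite product_measure1E //; try exact: mpre.
by rewrite EFinM muleACA.
Qed.

Lemma scales_area_swap : scales_area (fun p => (p.2, p.1)) 1.
Proof.
apply: scales_area_rect => //; first exact: measurable_fun_pair.
move=> A B mA mB; rewrite mul1e.
have -> : (fun p : C => (p.2, p.1)) @^-1` (A `*` B) = B `*` A.
  by apply/seteqP; split => -[x y] /= []; split.
by rewrite product_measure1E// muleC.
Qed.

(** By Fubini: every vertical section is translated. *)
Lemma scales_area_shear (a : R) : scales_area (fun p => (p.1, p.2 + a * p.1)) 1.
Proof.
have mf : measurable_fun [set: mR * mR] (fun p : mR * mR => (p.1, p.2 + a * p.1) : mR * mR).
  apply: measurable_fun_pair => //; apply: measurable_funD => //; apply: measurable_funM => //;
    exact: measurable_cst.
split => // A mA; rewrite mul1e /product_measure1.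
apply: eq_integral => x _ /=.
rewrite (lebesgue_affine (a * x) (oner_neq0 _)); last exact: measurable_xsection.
rewrite normr1 mul1e; congr (leb _).
by apply/seteqP; split => y; rewrite /xsection/= !inE /= mul1r.
Qed.

Lemma eq_scales_area f g k l : f =1 g -> k = l -> scales_area f k -> scales_area g l.
Proof. by move=> /funext -> ->. Qed.

(** Multiplication by (a, b) with a != 0 is an upper shear, a diagonal map and a
lower shear; b i is the product of 1 + i and (b / 2) (1 + i). *)
Lemma scales_area_cmul c : c != 0 -> scales_area (cmul c) (sqn c).
Proof.
have main (a b : R) : a != 0 -> scales_area (cmul (a, b)) (sqn (a, b)).
  move=> a0; have s0 : sqn (a, b) != 0 by rewrite sqn_eq0; apply: contra a0 => /eqP[-> _].
  have s1 : (a ^+ 2 + b ^+ 2) / a != 0 by rewrite mulf_neq0// invr_eq0.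
  have H1 := scales_area_comp scales_area_swap (scales_area_comp (scales_area_shear (- (b / a)))
    scales_area_swap).
  apply: (eq_scales_area _ _ (scales_area_comp (scales_area_comp H1 (scales_area_diag a0 s1))
    (scales_area_shear (b / a)))).
    move=> [x y]; rewrite /cmul/=; congr pair; field => //.
  rewrite !mulr1 mul1r -normrM mulrCA divff// mulr1 ger0_norm// addr_ge0 ?sqr_ge0//.
move: c => [a b] c0; have [a0|a0] := eqVneq a 0; last exact: main.
have b0 : b != 0 by apply: contra c0 => /eqP ->; rewrite a0.
have b2 : b / 2 != 0 by rewrite mulf_neq0// invr_eq0.
apply: (eq_scales_area _ _ (scales_area_comp (main (b/2) (b/2) b2) (main 1 1 (oner_neq0 _)))).
  by move=> [x y]; rewrite a0 /cmul/=; congr pair; field.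
by rewrite a0 /sqn/=; field.
Qed.

(** * Strict complex differentiability *)

Lemma nbhs_deltaP (V : normedModType R) (x : V) (P : set V) :
  nbhs x P <-> exists2 d : R, 0 < d & forall y, `|y - x| < d -> P y.
Proof.
split=> [/nbhs_normP[d /= d0 h]|[d d0 h]].
  by exists d => // y yx; apply: h; rewrite /ball_/= distrC.
by apply/nbhs_normP; exists d => // y /=; rewrite distrC; exact: h.
Qed.

Lemma continuous_deltaP (V W : normedModType R) (f : V -> W) (x : V) :
  {for x, continuous f} <-> forall e : R, 0 < e -> exists2 d : R, 0 < d & forall y,
    `|y - x| < d -> `|f y - f x| < e.
Proof.
split=> [h e e0|h].
  have /nbhs_deltaP[d d0 H] : nbhs x (fun y => `|f y - f x| < e).
    by apply: (h [set z | `|z - f x| < e]); apply/nbhs_deltaP; exists e.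
  by exists d.
move=> P /nbhs_deltaP[e e0 He]; have [d d0 Hd] := h _ e0.
by apply/nbhs_deltaP; exists d => // y /Hd /He.
Qed.

Lemma open_deltaP (V : normedModType R) (A : set V) : open A <->
  forall x, A x -> exists2 d : R, 0 < d & forall y, `|y - x| < d -> A y.
Proof.
rewrite openE; split => [h x /h|h x /h] /=; first by move/nbhs_deltaP.
by move=> H; apply/nbhs_deltaP.
Qed.

Definition csquare (x : C) (r : R) : set C := [set p | `|p - x| <= r].

Lemma csquareE x r : csquare x r = `[x.1 - r, x.1 + r]%classic `*` `[x.2 - r, x.2 + r]%classic.
Proof.
have h (a b : R) : (`|a - b| <= r) = (b - r <= a <= b + r) by rewrite ler_norml; lra.
by apply/seteqP; split => p /=; rewrite /csquare/= norm_le /= !h !in_itv/= => /andP.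
Qed.

Lemma compact_csquare x r : compact (csquare x r).
Proof. by rewrite csquareE; apply: compact_setX; exact: segment_compact. Qed.

(** Unlike plain differentiability, the two points p and q both vary: this gives
local injectivity, and continuity of the derivative, from the definition alone. *)
Definition strict_cdiff (f : C -> C) (c x : C) := forall e : R, 0 < e -> exists2 d : R, 0 < d &
  forall p q, `|p - x| < d -> `|q - x| < d -> `|f p - f q - cmul c (p - q)| <= e * `|p - q|.

Lemma strict_cdiff_lipschitz f c x : strict_cdiff f c x -> exists K d : R, [/\ 0 < K, 0 < d &
  forall p q, `|p - x| < d -> `|q - x| < d -> `|f p - f q| <= K * `|p - q|].
Proof.
move=> /(_ 1 ltr01)[d d0 h]; exists (1 + 2 * `|c|), d; split => //.
move=> p q px qx; rewrite -(subrK (cmul c (p - q)) (f p - f q)) mulrDl.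
by rewrite (le_trans (ler_normD _ _))// lerD ?h// norm_cmul.
Qed.

Lemma lipschitz_continuous (V W : normedModType R) (f : V -> W) (x : V) (K d : R) : 0 < K ->
  0 < d ->
  (forall y, `|y - x| < d -> `|f y - f x| <= K * `|y - x|) -> {for x, continuous f}.
Proof.
move=> K0 d0 h; apply/continuous_deltaP => e e0.
exists (Num.min d (e / K)); first by rewrite lt_min d0 divr_gt0.
move=> y; rewrite lt_min => /andP[yd ye]; rewrite (le_lt_trans (h _ yd))//.
by rewrite mulrC -ltr_pdivlMr.
Qed.

Lemma strict_cdiff_continuous f c x : strict_cdiff f c x -> {for x, continuous f}.
Proof.
move=> /strict_cdiff_lipschitz[K [d [K0 d0 h]]]; apply: (lipschitz_continuous K0 d0) => p px.
by apply: h => //; rewrite subrr normr0.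
Qed.

Lemma cmul_lower c p : c != 0 -> `|p| <= 2 * `|cinv c| * `|cmul c p|.
Proof. by move=> c0; rewrite -{1}(cmulVK p c0) norm_cmul. Qed.

Lemma strict_cdiff_bilipschitz f c x : c != 0 -> strict_cdiff f c x ->
  exists k d : R, [/\ 0 < k, 0 < d &
  forall p q, `|p - x| < d -> `|q - x| < d -> k * `|p - q| <= `|f p - f q|].
Proof.
move=> c0 fc; set m := `|cinv c|.
have m0 : 0 < m by rewrite normr_gt0 cinv_neq0.
have k0 : 0 < (4 * m)^-1 by rewrite invr_gt0 mulr_gt0.
(* 1 / (4 m) is half of the lower bound 1 / (2 m) of multiplication by c *)
have [d d0 h] := fc _ k0; exists (4 * m)^-1, d; split => // p q px qx.
have h1 := h _ _ px qx.
have h2 := cmul_lower (p - q) c0.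
have h3 : `|cmul c (p - q)| <= `|f p - f q| + `|f p - f q - cmul c (p - q)|.
  by rewrite -[in leLHS](subKr (f p - f q) (cmul _ _)) ler_normB.
rewrite -(ler_pM2l m0) in h1; rewrite -(ler_pM2l m0) in h3.
rewrite -(ler_pM2l m0).
have e1 : m * ((4 * m)^-1 * `|p - q|) = `|p - q| / 4 by field; exact: lt0r_neq0.
rewrite e1 in h1 *. rewrite -/m in h2. lra.
Qed.

(** The inverse function theorem by minimisation: a point p minimising
|f p - y| on a small closed square is interior because f expands distances, and
if f p <> y then moving p along c^-1 (y - f p) would decrease the distance. *)
Lemma strict_cdiff_open_map f c x (r : R) : c != 0 -> strict_cdiff f c x -> 0 < r ->
  exists2 rho : R, 0 < rho &
  forall y, `|y - f x| < rho -> exists2 p, `|p - x| < r & f p = y.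
Proof.
move=> c0 fc r0; set m := `|cinv c|.
have m0 : 0 < m by rewrite normr_gt0 cinv_neq0.
have k0 : 0 < (4 * m)^-1 by rewrite invr_gt0 mulr_gt0.
have [d1 d10 h] := fc _ k0.
have [k [d2 [k2 d20 hlow]]] := strict_cdiff_bilipschitz c0 fc.
have [K [d3 [K3 d30 hup]]] := strict_cdiff_lipschitz fc.
set d := Num.min (Num.min d1 d2) (Num.min d3 r).
have d0 : 0 < d by rewrite !lt_min d10 d20 d30.
have hd p : `|p - x| <= d / 2 -> [/\ `|p - x| < d1, `|p - x| < d2, `|p - x| < d3 & `|p - x| < r].
  move=> hp; have : `|p - x| < d by apply: (le_lt_trans hp); rewrite ltr_pdivrMr// ltr_pMr// ltr1n.
  by rewrite !lt_min => /andP[/andP[-> ->] /andP[-> ->]].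
have xx : `|x - x| <= d / 2 by rewrite subrr normr0 divr_ge0// ltW.
exists (k * (d / 2) / 2); first by rewrite !divr_gt0// mulr_gt0// divr_gt0.
move=> y yx.
have [] := @compact_EVT_min _ R (fun p => `|f p - y|) (csquare x (d / 2)).
- by exists x.
- exact: compact_csquare.
- apply: continuous_in_subspaceT => p; rewrite inE => /hd[_ _ p3 _].
  apply: (@lipschitz_continuous _ _ _ _ K (d3 - `|p - x|)) => //; first by rewrite subr_gt0.
  move=> q; rewrite ltrBrDr => qp; rewrite (le_trans (ler_dist_dist _ _))// opprB addrA subrK;
    apply: hup => //.
  by rewrite (le_lt_trans (ler_distD p _ _)).
move=> p; rewrite inE => px hmin.
have hx := hmin x (mem_set xx).
have [px1 px2 px3 px4] := hd _ px.
have [xx1 xx2 xx3 xx4] := hd _ xx.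
have pd : `|p - x| < d / 2.
  rewrite lt_neqAle px andbT; apply/eqP => pxE.
  have := hlow p x px2 xx2; rewrite pxE.
  have : `|f p - f x| <= `|f p - y| + `|y - f x| by exact: ler_distD.
  rewrite (distrC (f x)) in hx. lra.
exists p => //; apply/eqP; rewrite -subr_eq0 -normr_eq0; apply/eqP.
set g := `|f p - y| in hx *; apply/eqP; apply: contraT => g0.
have {}g0 : 0 < g by rewrite lt_neqAle eq_sym g0 /g /=.
set v := cmul (cinv c) (y - f p).
have hv : `|v| <= 2 * m * g by rewrite /g (distrC (f p)) norm_cmul.
(* the step is short enough for q to stay in the square *)
set h0 := Num.min 1 ((d / 2 - `|p - x|) / (2 * m * g)).
have mg : 0 < 2 * m * g by rewrite !mulr_gt0.
have h00 : 0 < h0 by rewrite lt_min ltr01 divr_gt0// subr_gt0.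
have h01 : h0 <= 1 by rewrite ge_min lexx.
have hh0 : h0 * (2 * m * g) <= d / 2 - `|p - x| by rewrite -ler_pdivlMr// ge_min lexx orbT.
set q := p + h0 *: v.
have hq0 : `|h0 *: v| <= h0 * (2 * m * g) by rewrite normrZ gtr0_norm// ler_pM2l.
have qx : `|q - x| <= d / 2.
  by rewrite /q addrAC (le_trans (ler_normD _ _))// -lerBrDl (le_trans hq0).
have [qx1 _ _ _] := hd _ qx.
have := h _ _ qx1 px1.
have -> : q - p = h0 *: v by rewrite /q addrC addKr.
rewrite cmulZr /v cmulKV// -/v => H.
have := hmin q (mem_set qx); rewrite -/g.
have : `|f q - y| <= `|f q - f p - h0 *: (y - f p)| + `|(1 - h0) *: (f p - y)|.
  rewrite (le_trans _ (ler_normD _ _))// le_eqVlt; apply/orP; left; apply/eqP; congr `|_|.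
  by rewrite !scale_pair; apply: pair_ext => /=; ring.
rewrite [in X in _ <= _ + X]normrZ -/g ger0_norm ?subr_ge0//.
have := ler_pM (ltW k0) (normr_ge0 _) (lexx _) hq0.
have -> : (4 * m)^-1 * (h0 * (2 * m * g)) = h0 * g / 2 by field; exact: lt0r_neq0.
have : 0 < h0 * g by rewrite mulr_gt0.
have eM : (1 - h0) * g = g - h0 * g by ring.
rewrite eM; lra.
Qed.

End Plane.

(** * Measurability in the plane *)

Section ChangeOfVariables.
Variable R : realType.
Local Notation C := (R * R)%type.
Local Notation mR := (measurableTypeR R).
Implicit Types (p q c : C).
Local Notation leb := (@lebesgue_measure R).
Local Notation leb2 := (leb \x leb)%E.

(** An open set is the countable union of the squares with rational centre and
radius 1 / (n + 1) that it contains. *)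
Lemma open_measurable2 (A : set (mR * mR)) : open (A : set C) -> measurable A.
Proof.
move=> /open_deltaP oA.
pose box (i : rat * rat * nat) : set (mR * mR) :=
  `](ratr i.1.1 - i.2.+1%:R^-1), (ratr i.1.1 + i.2.+1%:R^-1)[%classic `*` `](ratr i.1.2 -
    i.2.+1%:R^-1), (ratr i.1.2 + i.2.+1%:R^-1)[%classic.
pose B i := if `[< box i `<=` A >] then box i else set0.
have -> : A = \bigcup_i (B i).
  apply/seteqP; split => [x Ax|x [i _]]; last first.
    by rewrite /B; case: asboolP => // h /h.
  have [d d0 hd] := oA x Ax.
  have [n hn] : exists n : nat, n.+1%:R^-1 < d / 2 :> R.
    have d2 : 0 < d / 2 by rewrite divr_gt0.
    exists (Num.truncn (d / 2)^-1); rewrite -[ltRHS]invrK ltf_pV2 ?posrE ?invr_gt0//.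
    exact: truncnS_gt.
  have n0 : 0 < n.+1%:R^-1 :> R by [].
  have rt (a e : R) : 0 < e -> exists r : rat, `|a - ratr r| < e.
    move=> e0; have ab : a - e < a + e by lra.
    have [r] := rat_in_itvoo ab.
    rewrite in_itv/= => h; exists r; rewrite ltr_norml; lra.
  have [r1 h1] := rt x.1 _ n0; have [r2 h2] := rt x.2 _ n0.
  have hh (a b e : R) : (`|a - b| < e) = (b - e < a < b + e) by rewrite ltr_norml; lra.
  exists (r1, r2, n) => //; rewrite /B; case: asboolP => [_|].
    by rewrite /box/=; split; rewrite /= in_itv/= -hh.
  case; move=> y [] /=; rewrite !in_itv/= -!hh => y1 y2; apply: hd.
  move: (n.+1%:R^-1) hn n0 h1 h2 y1 y2 => e hn n0 h1 h2 y1 y2.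
  rewrite norm_lt; apply/andP; split.
    by have := ler_distD (ratr r1) y.1 x.1; rewrite (distrC (ratr _))/=; lra.
  by have := ler_distD (ratr r2) y.2 x.2; rewrite (distrC (ratr _))/=; lra.
apply: countable_bigcupT_measurable => [|i]; first exact: countableP.
rewrite /B; case: ifP => _ //.
by apply: measurableX; exact: measurable_itv.
Qed.

Lemma continuous_measurable2 (w : set C) (h : C -> R) : open w ->
  (forall x, w x -> {for x, continuous h}) -> measurable_fun (w : set (mR * mR)) (h : mR * mR -> R).
Proof.
move=> ow ch mw; apply: (measurability _ (RGenOpens.measurableE R)) => //.
move=> _ [_ [a [b ->] <-]]; apply: open_measurable2.
rewrite openE => x [wx hx]; apply: filterI; first exact: open_nbhs_nbhs.
by apply: ch => //; apply: open_nbhs_nbhs; split => //; exact: interval_open.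
Qed.

Lemma continuous_measurable2_pair (w : set C) (g : C -> C) : open w ->
  (forall x, w x -> {for x, continuous g}) -> measurable_fun (w : set (mR * mR)) (g : mR * mR ->
    mR * mR).
Proof.
move=> ow cg mw.
pose g1 : C -> R := fun x => (g x).1.
pose g2 : C -> R := fun x => (g x).2.
have c1 x : w x -> {for x, continuous g1}.
  by move=> wx; apply: (continuous_comp (cg _ wx)); exact: cvg_fst.
have c2 x : w x -> {for x, continuous g2}.
  by move=> wx; apply: (continuous_comp (cg _ wx)); exact: cvg_snd.
have m1 := continuous_measurable2 ow c1.
have m2 := continuous_measurable2 ow c2.
apply: (measurability _ (measurable_prod_measurableType mR mR)) => //.
move=> _ [_ [A mA [B mB <-]] <-].
have -> : w `&` g @^-1` (A `*` B) = (w `&` g1 @^-1` A) `&` (w `&` g2 @^-1` B).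
  by apply/seteqP; split => x /=; [move=> [? []]|move=> [[? ?] []]].
by apply: measurableI; [exact: m1|exact: m2].
Qed.

Lemma leb2_csquare (x : C) (r : R) : 0 <= r -> leb2 (csquare x r) = (4 * r ^+ 2)%:E.
Proof.
move=> r0; rewrite csquareE product_measure1E//=.
have h (a : R) : leb `[a - r, a + r]%classic = (2 * r)%:E.
  rewrite lebesgue_measure_itv/= lte_fin; case: ltP => [_|h]; first by rewrite -EFinB;
    congr EFin; ring.
  by congr EFin; lra.
by rewrite !h -EFinM; congr EFin; ring.
Qed.

(** * From small squares to all squares *)

Definition hsquare (p : C) (r : R) : set (mR * mR) := `[p.1, p.1 + r[%classic `*` `[p.2,
  p.2 + r[%classic.

Lemma measurable_hsquare p r : measurable (hsquare p r).
Proof. by apply: measurableX; exact: measurable_itv. Qed.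

Lemma leb2_hsquare p (r : R) : 0 < r -> leb2 (hsquare p r) = (r ^+ 2)%:E.
Proof.
move=> r0; rewrite product_measure1E//= !lebesgue_measure_itv/= !lte_fin !ltrDl r0 -!EFinD -EFinM.
by congr EFin; ring.
Qed.

Lemma hsquare_near p q (r : R) : hsquare p r q -> `|q - p| <= r.
Proof.
by rewrite /hsquare/= => -[]; rewrite /= !in_itv/= => h1 h2; rewrite norm_le/= !ler_norml; lra.
Qed.

(** A property of sets that is stable under disjoint union and true of all
sufficiently small squares near each point is true of every square. *)
Section LocalToGlobal.
Variable G : set (mR * mR) -> Prop.
Hypothesis GU : forall A B, measurable A -> measurable B -> A `&` B = set0 -> G A -> G B ->
  G (A `|` B).

Lemma hsquare_split p (r : R) : 0 < r ->
  (forall q, `|q - p| <= r -> G (hsquare q r)) -> G (hsquare p (2 * r)).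
Proof.
move=> r0 Gr.
have hx (x : R) : `[x, x + 2 * r[%classic = `[x, x + r[%classic `|` `[x + r, x + r + r[%classic.
  apply/seteqP; split => z /=; rewrite !in_itv/=.
    by case: (ltP z (x + r)) => h1 h2; [left|right]; lra.
  by case; lra.
have dx (x z : R) : `[x, x + r[%classic z -> ~ `[x + r, x + r + r[%classic z.
  by rewrite /= !in_itv/=; lra.
have mI := @measurableX _ _ mR mR.
have hrow (A : set mR) (y : R) : A `*` `[y, y + 2 * r[%classic = (A `*` `[y,
  y + r[%classic) `|` (A `*` `[y + r, y + r + r[%classic).
  by rewrite hx; apply/seteqP; split => z /=; tauto.
have Gcol (a b : R) : (forall y : R, `|y - b| <= r -> G (hsquare (a, y) r)) ->
  G (`[a, a + r[%classic `*` `[b, b + 2 * r[%classic).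
  move=> H; rewrite hrow; apply: GU; try by apply: mI; exact: measurable_itv.
  - by rewrite -subset0 => z [[_ h1] [_ h2]]; exact: dx h1 h2.
  - by have := H b; rewrite /hsquare/=; apply; rewrite subrr normr0 ltW.
  - by have := H (b + r); rewrite /hsquare/=; apply; rewrite addrC addKr gtr0_norm.
have -> : hsquare p (2 * r) = (`[p.1, p.1 + r[%classic `*` `[p.2,
  p.2 + 2 * r[%classic) `|` (`[p.1 + r, p.1 + r + r[%classic `*` `[p.2, p.2 + 2 * r[%classic).
  by rewrite /hsquare hx; apply/seteqP; split => z /=; tauto.
apply: GU; try by apply: mI; exact: measurable_itv.
- by rewrite -subset0 => z [[h1 _] [h2 _]]; exact: dx h1 h2.
- by apply: Gcol => y hy; apply: Gr; rewrite norm_le/= subrr normr0 hy ltW.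
- by apply: Gcol => y hy; apply: Gr; rewrite norm_le/= hy addrC addKr gtr0_norm ?lexx.
Qed.

Lemma hsquare_dyadic n p (r : R) : 0 < r ->
  (forall q, `|q - p| <= 2 ^+ n * r -> G (hsquare q r)) -> G (hsquare p (2 ^+ n * r)).
Proof.
elim: n p => [|n IH] p r0 H.
  by rewrite expr0 mul1r; apply: H; rewrite subrr normr0 expr0 mul1r ltW.
rewrite exprS -mulrA; apply: hsquare_split; first by rewrite mulr_gt0// exprn_gt0.
move=> q qp; apply: IH => // z zq; apply: H.
rewrite (le_trans (ler_distD q _ _))// exprS -mulrA [leRHS]mulr_natl mulr2n.
by rewrite lerD.
Qed.

(** Near-covering compactness makes the bound on the size of good squares uniform
over the closed square; then the dyadic subdivision is fine enough at some level. *)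
Lemma hsquare_local_to_global : (forall x : C, exists2 d : R, 0 < d & forall p (r : R),
  `|p - x| < d -> 0 < r < d -> G (hsquare p r)) ->
  forall p (r : R), 0 < r -> G (hsquare p r).
Proof.
move=> H p r r0.
have /compact_near_coveringP /(_ R (0:R)^'+ (fun s q => 0 < s ->
  G (hsquare q s))) := @compact_csquare R p r.
case.
  move=> x _; have [d d0 hd] := H x.
  exists ([set q | `|q - x| < d], [set s | s < d]) => /=.
    split; first by apply/nbhs_deltaP; exists d.
    by apply: nbhs_right_lt.
  by move=> [q s] /= [qd sd] s0; apply: hd => //; rewrite s0 sd.
move=> e /= e0 he.
have [n hn] : exists n : nat, r / 2 ^+ n < e.
  have := cvg_geometric r (ltac:(by rewrite ger0_norm ?invf_lt1 ?ltr1n) : `|2^-1 : R| < 1).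
  move=> /cvgrPdist_lt /(_ e e0) [n _ /(_ n (leqnn n))] /=.
  rewrite sub0r normrN exprVn ger0_norm; last by rewrite ltW// divr_gt0// exprn_gt0.
  by move=> h; exists n.
have s0 : 0 < r / 2 ^+ n by rewrite divr_gt0// exprn_gt0.
have rE : 2 ^+ n * (r / 2 ^+ n) = r by rewrite mulrCA divff ?mulr1// expf_neq0.
rewrite -rE; apply: hsquare_dyadic => // q; rewrite rE => qp.
apply: (he (r / 2 ^+ n)) => //=.
by rewrite sub0r normrN gtr0_norm.
Qed.

End LocalToGlobal.

(** * Conformal homeomorphisms *)

(** At a point y close to x, the increment of f between y and y + (t, 0) with t small
is governed both by c x and by c y. *)
Lemma strict_cdiff_deriv_continuous (w : set C) (f c : C -> C) : open w ->
  (forall x, w x -> strict_cdiff f (c x) x) -> forall x, w x -> {for x, continuous c}.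
Proof.
move=> ow fc x wx; apply/continuous_deltaP => e e0.
have e3 : 0 < e / 3 by rewrite divr_gt0.
have [d d0 hd] := fc x wx _ e3; have [d1 d10 hd1] := (open_deltaP w).1 ow x wx.
exists (Num.min d d1); first by rewrite lt_min d0.
move=> y; rewrite lt_min => /andP[yd yd1].
have [d2 d20 hd2] := fc y (hd1 _ yd1) _ e3.
set t := Num.min (d - `|y - x|) d2 / 2.
have t0 : 0 < t by rewrite divr_gt0// lt_min d20 subr_gt0 yd.
have tm : t < Num.min (d - `|y - x|) d2 by rewrite ltr_pdivrMr// ltr_pMr ?ltr1n// lt_min d20
  subr_gt0 yd.
move: tm; rewrite lt_min => /andP[t1 t2].
pose p : C := y + (t, 0).
have py : p - y = (t, 0) by rewrite /p addrC addKr.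
have np : `|p - y| = t.
  by apply/eqP; rewrite py eq_le norm_le/= normr0 gtr0_norm// lexx ltW//= -{1}(gtr0_norm t0)
    (norm1_le (t, 0)).
have px : `|p - x| < d by rewrite (le_lt_trans (ler_distD y _ _))// np; lra.
have h1 := hd p y px yd.
have yy : `|y - y| < d2 by rewrite subrr normr0.
have h2 := hd2 p y (ltac:(by rewrite np)) yy.
have : `|cmul (c y) (p - y) - cmul (c x) (p - y)| <= e / 3 * t + e / 3 * t.
  rewrite -[X in `|X|](subrKA (f p - f y)) -np (le_trans (ler_normD _ _))// addrC.
  by rewrite lerD// distrC.
rewrite -cmulBl py.
have -> : cmul (c y - c x) (t, 0) = t *: (c y - c x).
  by rewrite scale_pair /cmul/=; congr pair; ring.
rewrite normrZ gtr0_norm// -mulrDl mulrC ler_pM2r// => h; lra.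
Qed.

(** f and g are inverse homeomorphisms between the open sets w and w', and c is the
complex derivative of f; both directions are recorded so that the notion is
symmetric in f and g. *)
Definition conformal_pair (w w' : set C) (f g c : C -> C) :=
  [/\ open w, open w', (forall x, w x -> w' (f x) /\ g (f x) = x),
   (forall y, w' y -> w (g y) /\ f (g y) = y) &
   forall x, w x -> [/\ c x != 0, strict_cdiff f (c x) x & strict_cdiff g (cinv (c x)) (f x)]].

Lemma cinvK p : p != 0 -> cinv (cinv p) = p.
Proof.
move=> p0; have s0 : sqn p != 0 by rewrite sqn_eq0.
rewrite {1}/cinv sqn_cinv//.
by apply: pair_ext => /=; field.
Qed.

Lemma conformal_pair_sym w w' (f g c : C -> C) : conformal_pair w w' f g c ->
  conformal_pair w' w g f (fun y => cinv (c (g y))).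
Proof.
move=> [ow ow' fg gf h]; split => // y wy.
have [wg fgy] := gf y wy; have [c0 fc gc] := h _ wg.
by rewrite fgy in gc; split; rewrite ?cinvK ?cinv_neq0.
Qed.

(** The open mapping property makes the image open and the inverse continuous;
the lower Lipschitz bound then transfers strict differentiability to the inverse. *)
Lemma conformal_pair_inj (w : set C) (f c : C -> C) : open w ->
  (forall x y, w x -> w y -> f x = f y -> x = y) ->
  (forall x, w x -> c x != 0 /\ strict_cdiff f (c x) x) ->
  exists g, conformal_pair w (f @` w) f g c.
Proof.
move=> ow fi fc; pose g y := xget 0 [set x | w x /\ f x = y].
have gf x : w x -> g (f x) = x.
  move=> wx; rewrite /g; case: xgetP => [y _ [wy fy]|/(_ x)]; last by case.
  exact: fi.
exists g; split => //.
- apply/open_deltaP => _ [x wx <-]; have [c0 fcx] := fc x wx.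
  have [d d0 hd] := (open_deltaP w).1 ow x wx.
  have [rho rho0 hrho] := strict_cdiff_open_map c0 fcx d0.
  by exists rho => // y /hrho[p px <-]; exists p => //; exact: hd.
- by move=> x wx; split; [exists x|exact: gf].
- by move=> _ [x wx <-]; rewrite gf.
- move=> x wx; have [c0 fcx] := fc x wx; split => // e e0.
  have [k [d2 [k0 d20 hlow]]] := strict_cdiff_bilipschitz c0 fcx.
  set m := `|cinv (c x)|.
  have m0 : 0 < m by rewrite normr_gt0 cinv_neq0.
  have e'0 : 0 < e * k / (2 * m) by rewrite !mulr_gt0// ?invr_gt0 ?mulr_gt0.
  have [d1 d10 hd1] := fcx _ e'0.
  have [d3 d30 hd3] := (open_deltaP w).1 ow x wx.
  have d0 : 0 < Num.min d1 (Num.min d2 d3) by rewrite !lt_min d10 d20.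
  have [rho rho0 hrho] := strict_cdiff_open_map c0 fcx d0.
  exists rho => // _ _ /hrho[p px <-] /hrho[q qx <-].
  move: px qx; rewrite !lt_min => /and3P[px1 px2 px3] /and3P[qx1 qx2 qx3].
  rewrite !gf; [|exact: hd3|exact: hd3].
  have -> : p - q - cmul (cinv (c x)) (f p - f q) = cmul (cinv (c x)) (cmul (c x)
    (p - q) - (f p - f q)).
    by rewrite [RHS]cmulBr cmulVK.
  apply: (le_trans (norm_cmul _ _)); rewrite -/m distrC.
  have h1 := hd1 _ _ px1 qx1; have h2 := hlow _ _ px2 qx2.
  have m20 : 0 < 2 * m by rewrite mulr_gt0.
  rewrite -(ler_pM2l m20) in h1; apply: (le_trans h1).
  have -> : 2 * m * (e * k / (2 * m) * `|p - q|) = e * (k * `|p - q|) by field; exact: lt0r_neq0.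
  by rewrite ler_pM2l.
Qed.

(** * Change of variables for conformal maps *)

(** One inequality suffices for the change of variables formula: applied to the
inverse map and to the pulled back integrand it gives the other one. *)
Section Inequality.
Variables (w w' : set C) (f g c : C -> C) (h : C -> R).
Hypothesis fgc : conformal_pair w w' f g c.
Hypothesis h0 : forall y, w' y -> 0 <= h y.
Hypothesis ch : forall y, w' y -> {for y, continuous h}.

Let k x := h (f x) * sqn (c x).

Let ow : open w. Proof. by case: fgc. Qed.

Let ow' : open w'. Proof. by case: fgc. Qed.

Let fw x : w x -> w' (f x). Proof. by case: fgc => _ _ H _ _ /H[]. Qed.

Let gf x : w x -> g (f x) = x. Proof. by case: fgc => _ _ H _ _ /H[]. Qed.

Let fg y : w' y -> f (g y) = y. Proof. by case: fgc => _ _ _ H _ /H[]. Qed.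

Let cf x : w x -> strict_cdiff f (c x) x. Proof. by case: fgc => _ _ _ _ H /H[]. Qed.

Lemma sqn_continuous : continuous (@sqn R).
Proof.
move=> x; apply: cvgD.
- by apply: (continuous_comp (f := fst) (g := fun a : R => a ^+ 2));
  [exact: cvg_fst|exact: exprn_continuous].
- by apply: (continuous_comp (f := snd) (g := fun a : R => a ^+ 2));
  [exact: cvg_snd|exact: exprn_continuous].
Qed.

Let ck x : w x -> {for x, continuous k}.
Proof.
move=> wx; apply: continuousM; first exact: (continuous_comp (strict_cdiff_continuous (cf wx))
  (ch (fw wx))).
apply: (continuous_comp (strict_cdiff_deriv_continuous ow cf wx)); exact: sqn_continuous.
Qed.

Let k0 x : w x -> 0 <= k x.
Proof. by move=> wx; rewrite mulr_ge0 ?sqn_ge0 ?h0//; exact: fw. Qed.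

Let mk : measurable_fun (w : set (mR * mR)) (EFin \o k).
Proof. by apply/measurable_EFinP; exact: continuous_measurable2. Qed.

Let mh : measurable_fun (w' : set (mR * mR)) (EFin \o h).
Proof. by apply/measurable_EFinP; exact: continuous_measurable2. Qed.

Let mw : measurable (w : set (mR * mR)). Proof. exact: open_measurable2. Qed.

Let mw' : measurable (w' : set (mR * mR)). Proof. exact: open_measurable2. Qed.

Let measurable_imf (A : set (mR * mR)) : measurable A -> A `<=` w ->
  measurable (f @` A : set (mR * mR)).
Proof.
move=> mA Aw; have cg y : w' y -> {for y, continuous g}.
  move=> wy; have [_ _ _ H1 H2] := fgc; have [wg fgy] := H1 _ wy.
  by have [_ _] := H2 _ wg; rewrite fgy => /strict_cdiff_continuous.
have := continuous_measurable2_pair ow' cg mw' mA.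
congr measurable; apply/seteqP; split => y /=.
  by move=> [wy Ag]; exists (g y) => //; exact: fg.
by move=> [x Ax <-]; rewrite gf; [split=> //; apply/fw|]; exact: Aw.
Qed.

Section Compact.
Variables (K : set C) (e : R).
Hypotheses (cK : compact K) (Kw : K `<=` w) (e0 : 0 < e).

Let mK : measurable (K : set (mR * mR)).
Proof.
rewrite -[K]setCK; apply: measurableC; apply: open_measurable2.
by rewrite openC; apply: compact_closed => //; exact: norm_hausdorff.
Qed.

Let nu (A : set (mR * mR)) : \bar R := (\int[leb2]_(y in f @` (K `&` A)) (h y)%:E)%E.

Let mu (A : set (mR * mR)) : \bar R := (\int[leb2]_(x in w `&` A) (k x)%:E)%E.

Let G (A : set (mR * mR)) : Prop := (nu A <= mu A + e%:E * leb2 A)%E.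

Lemma change_of_variables_additive A B : measurable A -> measurable B -> A `&` B = set0 -> G A ->
  G B -> G (A `|` B).
Proof.
move=> mA mB AB GA GB; rewrite /G.
have -> : leb2 (A `|` B) = (leb2 A + leb2 B)%E by rewrite measureU.
have -> : mu (A `|` B) = (mu A + mu B)%E.
  rewrite /mu setIUr ge0_integral_setU//; [exact: measurableI|exact: measurableI| | |].
  - by apply: (measurable_funS mw) => // x [|] [].
  - by move=> x [|] [wx _]; rewrite lee_fin k0.
  - by apply/disj_setPS => x [[_ Ax] [_ Bx]]; rewrite -AB.
have -> : nu (A `|` B) = (nu A + nu B)%E.
  have m1 : measurable (f @` (K `&` A) : set (mR * mR)).
    by apply: measurable_imf; [exact: measurableI|move=> x [/Kw]].
  have m2 : measurable (f @` (K `&` B) : set (mR * mR)).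
    by apply: measurable_imf; [exact: measurableI|move=> x [/Kw]].
  rewrite /nu setIUr image_setU ge0_integral_setU//.
  - apply: (measurable_funS mw') => // y [|] [x [/Kw wx _] <-]; exact: fw.
  - by move=> y [|] [x [/Kw wx _] <-]; rewrite lee_fin h0//; exact: fw.
  - apply/disj_setPS => y [[x [/Kw wx Ax] <-] [x' [/Kw wx' Bx']]].
    move=> /(congr1 g); rewrite !gf// => x'x; suff : (A `&` B) x by rewrite AB.
    by split => //; rewrite -x'x.
have := leeD GA GB; rewrite /G => /le_trans; apply.
by rewrite addeACA -ge0_muleDr.
Qed.

(** The similar square that will contain the image of a small square. *)
Let scales_area_preimage (c0 b : C) (r : R) : c0 != 0 -> 0 <= r ->
  leb2 ((fun y => cmul (cinv c0) (y - b)) @^-1` (csquare 0 r)) = (sqn c0 * (4 * r ^+ 2))%:E.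
Proof.
move=> c00 r0; have [_ H] := scales_area_cmul (cinv_neq0 c00).
have -> : (fun y => cmul (cinv c0) (y - b)) @^-1` (csquare 0 r) = cmul (cinv c0) @^-1` (csquare
  (cmul (cinv c0) b) r).
  by apply/seteqP; split => y; rewrite /csquare/= cmulBr subr0.
have m : measurable (csquare (cmul (cinv c0) b) r : set (mR * mR)).
  by rewrite csquareE; apply: measurableX; exact: measurable_itv.
have s0 : sqn c0 != 0 by rewrite sqn_eq0.
have := H _ m; rewrite leb2_csquare// sqn_cinv//.
set a := (leb2 _) => /(congr1 (fun z => (sqn c0)%:E * z)%E).
by rewrite -EFinM => ->; rewrite muleA -EFinM divff// mul1e.
Qed.

(** Off K the left-hand side vanishes for small squares.  At a point x of K the
image of a square of side r lies in a similar square of side (1 + eta) |c x| r,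
and both integrands are almost constant. *)
Lemma change_of_variables_local x : exists2 d : R, 0 < d & forall p (r : R), `|p - x| < d ->
  0 < r < d -> G (hsquare p r).
Proof.
have hpos (A : set (mR * mR)) : (0 <= mu A)%E.
  by apply: integral_ge0 => y [wy _]; rewrite lee_fin k0.
have [Kx|nKx] := pselect (K x); last first.
  have oK : open (~` K) by rewrite openC; apply: compact_closed => //; exact: norm_hausdorff.
  have [d d0 hd] := (open_deltaP _).1 oK x nKx.
  exists (d / 2); first by rewrite divr_gt0.
  move=> p r px /andP[r0 rd]; rewrite /G.
  have -> : nu (hsquare p r) = 0%E.
    rewrite /nu (_ : _ `&` _ = set0) ?image_set0 ?integral_set0//.
    rewrite -subset0 => y [Ky /hsquare_near yp]; apply: (hd y) => //.
    by rewrite (le_lt_trans (ler_distD p _ _))//; lra.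
  by rewrite adde_ge0// mule_ge0// lee_fin ltW.
have wx := Kw Kx; set s := sqn (c x); set H := h (f x).
have c0 : c x != 0 by case: fgc => _ _ _ _ /(_ x wx)[].
have s0 : 0 < s by exact: sqn_gt0.
have H0 : 0 <= H by apply: h0; exact: fw.
set m := `|cinv (c x)|; have m0 : 0 < m by rewrite normr_gt0 cinv_neq0.
set eta := Num.min 1 (e / 2 / (s * (3 * H + 4))).
have t0 : 0 < s * (3 * H + 4) by rewrite mulr_gt0// ltr_wpDl// mulr_ge0.
have eta0 : 0 < eta by rewrite lt_min ltr01 !divr_gt0.
have eta1 : eta <= 1 by rewrite ge_min lexx.
(* 3 H + 4 bounds the slope in eta of (H + eta) (1 + eta)^2 for eta <= 1 *)
have etae : s * (3 * H + 4) * eta <= e / 2 by rewrite mulrC -ler_pdivlMr// ge_min lexx orbT.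
have [d1 d10 hd1] := (continuous_deltaP _ _).1 (continuous_comp (strict_cdiff_continuous (cf wx))
  (ch (fw wx))) _ eta0.
have e20 : 0 < e / 2 by rewrite divr_gt0.
have [d2 d20 hd2] := (continuous_deltaP _ _).1 (ck wx) _ e20.
have em0 : 0 < eta / (2 * m) by rewrite divr_gt0// mulr_gt0.
have [d3 d30 hd3] := cf wx em0.
have [d4 d40 hd4] := (open_deltaP _).1 ow x wx.
set d := Num.min (Num.min d1 d2) (Num.min d3 d4).
have d0 : 0 < d by rewrite !lt_min d10 d20 d30.
exists (d / 2); first by rewrite divr_gt0.
move=> p r px /andP[r0 rd].
have near q : hsquare p r q -> [/\ `|q - x| < d1, `|q - x| < d2, `|q - x| < d3 & `|q - x| < d4].
  move=> /hsquare_near qp; have : `|q - x| < d by rewrite (le_lt_trans (ler_distD p _ _))//; lra.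
  by rewrite !lt_min => /andP[/andP[-> ->] /andP[-> ->]].
have hw : hsquare p r `<=` w by move=> q /near[_ _ _ /hd4].
rewrite /G leb2_hsquare// -EFinM.
have mA : measurable (f @` (K `&` hsquare p r) : set (mR * mR)).
  by apply: measurable_imf; [apply: measurableI => //; exact: measurable_hsquare|move=> y [/Kw]].
have upper : (nu (hsquare p r) <= (H + eta)%:E * leb2 (f @` (K `&` hsquare p r)))%E.
  rewrite -integral_cst//; apply: ge0_le_integral => //.
  - by move=> y [q [/Kw wq _] <-]; rewrite lee_fin h0//; exact: fw.
  - by apply: (measurable_funS mw') => // y [q [/Kw wq _] <-]; exact: fw.
  - move=> y [q [/Kw wq /near[q1 _ _ _]] <-]; rewrite lee_fin.
    by have := hd1 _ q1; rewrite ltr_norml /= -/H; lra.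
have area : (leb2 (f @` (K `&` hsquare p r)) <= (s * (4 * ((1 + eta) * (r / 2)) ^+ 2))%:E)%E.
  (* the centre of the square *)
  pose a : C := p + (r / 2, r / 2).
  have ha q : hsquare p r q -> `|q - a| <= r / 2.
    by rewrite /hsquare/= => -[]; rewrite /= !in_itv/= => h1 h2; rewrite norm_le/= !ler_norml; lra.
  have hpa : hsquare p r a by split; rewrite /= in_itv/=; lra.
  have rho0 : 0 <= (1 + eta) * (r / 2) by rewrite mulr_ge0 ?divr_ge0 ?addr_ge0 ?ltW.
  rewrite -(scales_area_preimage (f a) c0 rho0); apply: le_measure; rewrite ?inE//.
    rewrite -[X in measurable X]setTI.
    apply: continuous_measurable2_pair => //; first exact: openT.
      move=> y _; apply: (@lipschitz_continuous _ _ _ _ _ (2 * m) 1) => //;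
        first by rewrite mulr_gt0.
      by move=> z _; rewrite -cmulBr opprB addrA subrK norm_cmul.
    by rewrite csquareE; apply: measurableX; exact: measurable_itv.
  move=> _ [q [Kq hq] <-]; rewrite /csquare/= subr0.
  have [_ _ q3 _] := near _ hq; have [_ _ a3 _] := near _ hpa.
  have -> : cmul (cinv (c x)) (f q - f a) = (q - a) + cmul (cinv (c x)) (f q - f a - cmul (c x)
    (q - a)).
    by rewrite [in RHS](cmulBr _ (f q - f a)) cmulVK// [RHS]addrC subrK.
  rewrite (le_trans (ler_normD _ _))// mulrDl mul1r lerD ?ha//.
  rewrite (le_trans (norm_cmul _ _))// -/m.
  have h1 := hd3 _ _ q3 a3.
  have m20 : 0 < 2 * m by rewrite mulr_gt0.
  rewrite -(ler_pM2l m20) in h1; apply: (le_trans h1).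
  have -> : 2 * m * (eta / (2 * m) * `|q - a|) = eta * `|q - a| by field; exact: lt0r_neq0.
  by rewrite ler_pM2l// ha.
have lower : ((H * s - e / 2)%:E * (r ^+ 2)%:E <= mu (hsquare p r))%E.
  rewrite -(leb2_hsquare p r0) /mu (setIidr hw).
  have [neg|pos] := ltP (H * s - e / 2) 0.
    apply: (@le_trans _ _ 0%E); last by have := hpos (hsquare p r); rewrite /mu (setIidr hw).
    by rewrite mule_le0_ge0// lee_fin ltW.
  rewrite -integral_cst; last exact: measurable_hsquare.
  apply: ge0_le_integral => //; first exact: measurable_hsquare.
  - by apply: (measurable_funS mw).
  - move=> q /near[_ q2 _ _]; rewrite lee_fin.
    by have := hd2 _ q2; rewrite ltr_norml /= /k -/s -/H; lra.
have He0 : (0 <= (H + eta)%:E)%E by rewrite lee_fin addr_ge0// ltW.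
apply: (le_trans upper); apply: (le_trans (lee_wpmul2l He0 area)).
apply: (le_trans _ (leeD lower (lexx _))).
rewrite -!EFinM -EFinD lee_fin.
have -> : (H * s - e / 2) * r ^+ 2 + e * r ^+ 2 = (H * s + e / 2) * r ^+ 2 by field.
have -> : (H + eta) * (s * (4 * ((1 + eta) * (r / 2)) ^+ 2)) = ((H + eta) * (1 + eta) ^+ 2 * s) *
  r ^+ 2 by field.
rewrite ler_pM2r ?exprn_gt0//.
have h1 : (1 + eta) ^+ 2 <= 1 + 3 * eta.
  have : 0 <= eta * (1 - eta) by rewrite mulr_ge0 ?subr_ge0// ltW.
  by rewrite expr2; lra.
have h2 : (H + eta) * (1 + eta) ^+ 2 <= H + (3 * H + 4) * eta.
  apply: (le_trans (ler_wpM2l _ h1)); first by rewrite addr_ge0// ltW.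
  have : 0 <= eta * (1 - eta) by rewrite mulr_ge0 ?subr_ge0// ltW.
  by lra.
apply: (le_trans (ler_wpM2r (ltW s0) h2)); rewrite mulrDl lerD2l.
by rewrite mulrC mulrA.
Qed.

Lemma change_of_variables_bounded (N : R) : 0 < N -> (forall x, K x -> `|x| <= N) ->
  (\int[leb2]_(y in f @` K) (h y)%:E <= \int[leb2]_(x in w) (k x)%:E + (e * (3 * N) ^+ 2)%:E)%E.
Proof.
move=> N0 hN.
have := hsquare_local_to_global change_of_variables_additive change_of_variables_local (- N,
  - N) (r := 3 * N).
move=> /(_ (ltac:(by rewrite mulr_gt0))); rewrite /G leb2_hsquare ?mulr_gt0// => H.
have KE : K `&` hsquare (- N, - N) (3 * N) = K.
  apply/setIidPl => x /hN; rewrite /= norm_le !ler_norml => hx.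
  by rewrite /hsquare; split; rewrite /= in_itv/=; lra.
rewrite /nu KE -EFinM in H; apply: (le_trans H); apply: leeD => //.
apply: ge0_subset_integral => //; first by apply: measurableI => //; exact: measurable_hsquare.
Qed.

End Compact.

Lemma change_of_variables_compact K : compact K -> K `<=` w ->
  (\int[leb2]_(y in f @` K) (h y)%:E <= \int[leb2]_(x in w) (k x)%:E)%E.
Proof.
move=> cK Kw; have [M [_ /(_ (`|M| + 1))]] := compact_bounded cK.
move=> /(_ (ltac:(by rewrite (le_lt_trans (ler_norm _))// ltrDl))) hM.
set N := `|M| + 1 in hM; have N0 : 0 < N by rewrite ltr_wpDl.
apply/lee_addgt0Pr => e e0.
have N30 : 0 < (3 * N) ^+ 2 by rewrite exprn_gt0// mulr_gt0.
have e'0 : 0 < e / (3 * N) ^+ 2 by rewrite divr_gt0.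
have := change_of_variables_bounded cK Kw e'0 N0 hM.
by rewrite mulfVK// lt0r_neq0.
Qed.

Let inner n : set C := [set x | `|x| <= n%:R /\ forall y, `|y - x| < n.+1%:R^-1 -> w y].

Let inner_sub n : inner n `<=` w.
Proof. by move=> x [_]; apply; rewrite subrr normr0. Qed.

Let inner_closed n : closed (inner n).
Proof.
rewrite -[inner n]setCK closedC; apply/open_deltaP => x nx.
have [xn|xn] := leP `|x| n%:R; last first.
  exists (`|x| - n%:R); first by rewrite subr_gt0.
  move=> y yx [yn _]; have := ler_normB x y.
  have := ler_normD (x - y) y; rewrite subrK distrC; lra.
have /existsNP[y /not_implyP[yx wy]] : ~ (forall y, `|y - x| < n.+1%:R^-1 -> w y).
  by move=> H; apply: nx.
exists (n.+1%:R^-1 - `|y - x|); first by rewrite subr_gt0.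
move=> z zx [_ /(_ y)]; apply: contra_not wy; apply.
by rewrite (le_lt_trans (ler_distD x _ _))// (distrC x) -ltrBrDl.
Qed.

Let inner_compact n : compact (inner n).
Proof.
apply: (subclosed_compact _ (@compact_csquare R 0 n%:R)); first exact: inner_closed.
by move=> x [xn _]; rewrite /csquare/= subr0.
Qed.

Let inner_bigcup : \bigcup_n inner n = w.
Proof.
apply/seteqP; split => [x [n _]|x wx]; first exact: inner_sub.
have [d d0 hd] := (open_deltaP _).1 ow x wx.
pose n := Num.truncn (Num.max `|x| d^-1).
have hn : Num.max `|x| d^-1 < n.+1%:R by exact: truncnS_gt.
move: hn; rewrite gt_max => /andP[h1 h2].
exists n.+1 => //; split; first exact: ltW.
move=> y yx; apply: hd; apply: (lt_trans yx).
rewrite -[ltRHS]invrK ltf_pV2 ?posrE ?invr_gt0//; apply: (lt_trans h2).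
by rewrite ltr_nat.
Qed.

(** Exhaustion of w by compact sets and monotone convergence. *)
Lemma change_of_variables_le : (\int[leb2]_(y in w') (h y)%:E <= \int[leb2]_(x in w)
  (h (f x) * sqn (c x))%:E)%E.
Proof.
have innerS n m : (n <= m)%N -> inner n `<=` inner m.
  move=> nm x [xn hx]; split; first by rewrite (le_trans xn)// ler_nat.
  by move=> y yx; apply: hx; rewrite (lt_le_trans yx)// lef_pV2 ?posrE// ler_nat.
have minner n : measurable (inner n : set (mR * mR)).
  by rewrite -[inner n]setCK; apply: measurableC; apply: open_measurable2; rewrite openC.
have fbigcup : \bigcup_n (f @` inner n) = w'.
  rewrite -image_bigcup inner_bigcup; apply/seteqP; split => [_ [x wx <-]|y wy]; first exact: fw.
  by exists (g y); [case: fgc => _ _ _ /(_ y wy)[]|exact: fg].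
have subw' n : f @` inner n `<=` w' by move=> _ [x /inner_sub wx <-]; exact: fw.
have := @ge0_nondecreasing_set_cvg_integral _ _ R (fun n => f @` inner n : set (mR * mR))
  (EFin \o h) leb2.
rewrite fbigcup => cvg_int.
have {}cvg_int : (\int[leb2]_(x in f @` inner n) (h x)%:E)%E @[n --> \oo] --> (\int[leb2]_(x in
  w') (h x)%:E)%E.
  apply: cvg_int.
  - by move=> n m nm; apply/subsetPset; apply: image_subset; exact: innerS.
  - by move=> n; apply: measurable_imf.
  - by move=> n; apply: (measurable_funS mw').
  - by move=> n y /subw' wy; rewrite lee_fin h0.
rewrite -(cvg_lim _ cvg_int)//; apply: lime_le; first by apply/cvg_ex; eexists; exact: cvg_int.
by apply: nearW => n; apply: change_of_variables_compact.
Qed.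

End Inequality.

Lemma change_of_variables w w' (f g c : C -> C) (h : C -> R) : conformal_pair w w' f g c ->
  (forall y, w' y -> 0 <= h y) -> (forall y, w' y -> {for y, continuous h}) ->
  (\int[leb2]_(y in w') (h y)%:E = \int[leb2]_(x in w) (h (f x) * sqn (c x))%:E)%E.
Proof.
move=> fgc h0 ch; apply/eqP; rewrite eq_le (change_of_variables_le fgc)//=.
have [ow ow' fw gw hc] := fgc.
have cf x : w x -> strict_cdiff f (c x) x by move=> /hc[].
apply: (le_trans (change_of_variables_le (conformal_pair_sym fgc) _ _)).
- by move=> x wx; rewrite mulr_ge0 ?sqn_ge0// h0//; exact: (fw _ wx).1.
- move=> x wx; apply: continuousM; first exact: (continuous_comp (strict_cdiff_continuous (cf _
  wx)) (ch _ (fw _ wx).1)).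
  by apply: (continuous_comp (strict_cdiff_deriv_continuous ow cf wx)); exact: sqn_continuous.
- rewrite le_eqVlt; apply/orP; left; apply/eqP; apply: eq_integral => y; rewrite inE => wy.
  have [wg fgy] := gw y wy; have [c0 _ _] := hc _ wg.
  by rewrite fgy sqn_cinv// mulfK// sqn_eq0.
Qed.

(** Positive and negative parts are treated separately, so no integrability is
assumed: both sides take the same conventional value when the integral diverges. *)
Lemma Rintegral_change_of_variables w w' (f g c : C -> C) (h k : C ->
  R) : conformal_pair w w' f g c ->
  (forall y, w' y -> {for y, continuous h}) -> (forall x, w x -> k x = h (f x) * sqn (c x)) ->
  (\int[leb2]_(y in w') h y = \int[leb2]_(x in w) k x)%R.
Proof.
move=> fgc ch kE; rewrite /Rintegral; congr fine; rewrite [LHS]integralE [RHS]integralE.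
have [ow ow' fw gw hc] := fgc.
have pos (h' k' : C -> R) : (forall y, w' y -> {for y, continuous h'}) -> (forall x, w x ->
  k' x = h' (f x) * sqn (c x)) ->
    (\int[leb2]_(y in w') (Num.max (h' y) 0)%:E = \int[leb2]_(x in w) (Num.max (k' x) 0)%:E)%E.
  move=> ch' kE'; rewrite (change_of_variables fgc).
  - apply: eq_integral => x; rewrite inE => wx; rewrite kE'//.
    by rewrite maxr_pMl ?sqn_ge0// mul0r.
  - by move=> y _; rewrite le_max lexx orbT.
  - by move=> y wy; apply: continuous_max; [exact: ch'|exact: cst_continuous].
have intpos (A : set (mR * mR)) (u : C -> R) :
    (\int[leb2]_(y in A) (fun y => (u y)%:E)^\+%E y = \int[leb2]_(y in A) (Num.max (u y) 0)%:E)%E.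
  by apply: eq_integral => y _; rewrite funeposE EFin_max.
have intneg (A : set (mR * mR)) (u : C -> R) :
    (\int[leb2]_(y in A) (fun y => (u y)%:E)^\-%E y = \int[leb2]_(y in A) (Num.max (- u y) 0)%:E)%E.
  by apply: eq_integral => y _; rewrite funenegE EFin_max.
congr (_ - _)%E; first by rewrite !intpos; exact: pos.
rewrite !intneg; apply: (pos (fun y => - h y) (fun x => - k x)).
- by move=> y wy; apply: continuousN; exact: ch.
- by move=> x wx; rewrite kE// mulNr.
Qed.

End ChangeOfVariables.

(** * Calculus along curves *)

Section Calculus.
Variable R : realType.
Local Notation C := (R * R)%type.
Implicit Types (p q c : C).

Lemma is_derive_cvgP (V W : normedModType R) (x v : V) (f : V -> W) (df : W) :
  is_derive x v f df <-> (fun h : R => h^-1 *: (f (h *: v + x) - f x)) @ 0^' --> df.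
Proof.
split => [[dfx <-]|h]; first exact: dfx.
have dx : derivable f x v by apply/cvg_ex; exists df.
apply: DeriveDef => //; exact: cvg_lim.
Qed.

Lemma is_derive_fst (V : normedModType R) (x v : V) (f : V -> C) (df : C) :
  is_derive x v f df -> is_derive x v (fun y => (f y).1) df.1.
Proof.
move=> /is_derive_cvgP h; apply/is_derive_cvgP.
by apply: (cvg_comp (fun h : R => h^-1 *: (f (h *: v + x) - f x)) fst h); exact: cvg_fst.
Qed.

Lemma is_derive_snd (V : normedModType R) (x v : V) (f : V -> C) (df : C) :
  is_derive x v f df -> is_derive x v (fun y => (f y).2) df.2.
Proof.
move=> /is_derive_cvgP h; apply/is_derive_cvgP.
by apply: (cvg_comp (fun h : R => h^-1 *: (f (h *: v + x) - f x)) snd h); exact: cvg_snd.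
Qed.

Lemma is_derive_pair (V : normedModType R) (x v : V) (f1 f2 : V -> R) (d1 d2 : R) :
  is_derive x v f1 d1 -> is_derive x v f2 d2 -> is_derive x v (fun y => (f1 y, f2 y) : C) (d1, d2).
Proof.
move=> /is_derive_cvgP h1 /is_derive_cvgP h2; apply/is_derive_cvgP.
exact: (cvg_pair h1 h2).
Qed.

Lemma is_derive_line (V W : normedModType R) (f : V -> W) (q v : V) (t : R) (df : W) :
  is_derive (q + t *: v) v f df -> is_derive t (1 : R) (fun s => f (q + s *: v)) df.
Proof.
move=> /is_derive_cvgP h; apply/is_derive_cvgP; apply: cvg_trans h.
apply: near_eq_cvg; near=> s; congr (_ *: (f _ - _)).
by rewrite scaler1 scalerDl addrCA addrA.
Unshelve. all: by end_near. Qed.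

Lemma is_derive_continuous (W : normedModType R) (f : R -> W) (x : R) (df : W) :
  is_derive x (1 : R) f df -> {for x, continuous f}.
Proof. by move=> [h _]; apply: differentiable_continuous; apply/derivable1_diffP. Qed.

Lemma mean_value_bound (f df : R -> R) (a b M : R) : a <= b ->
  (forall x, a <= x <= b -> is_derive x (1 : R) f (df x)) -> (forall x, a <= x <= b ->
    `|df x| <= M) ->
  `|f b - f a| <= M * (b - a).
Proof.
move=> ab hf hM; have [||c] := @MVT_segment R f df a b ab.
- by move=> x; rewrite in_itv/= => /andP[h1 h2]; apply: hf; rewrite !ltW.
- apply: continuous_in_subspaceT => x; rewrite inE/= in_itv/= => h.
  exact: (is_derive_continuous (hf x h)).
- rewrite in_itv/= => /hM h ->; rewrite normrM (ger0_norm (_ : 0 <= b - a)) ?subr_ge0//.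
  by rewrite ler_wpM2r ?subr_ge0.
Qed.

Lemma nonincreasing_bound (f df : R -> R) (a b : R) : a <= b ->
  (forall x, a <= x <= b -> is_derive x (1 : R) f (df x)) -> (forall x, a <= x <= b -> df x <= 0) ->
  f b <= f a.
Proof.
move=> ab hf hM; have [||c] := @MVT_segment R f df a b ab.
- by move=> x; rewrite in_itv/= => /andP[h1 h2]; apply: hf; rewrite !ltW.
- apply: continuous_in_subspaceT => x; rewrite inE/= in_itv/= => h.
  exact: (is_derive_continuous (hf x h)).
- rewrite in_itv/= => /hM h E; rewrite -subr_le0 E mulr_le0_ge0// subr_ge0//.
Qed.

(** A function that can only decrease as long as it stays below m > f 0 never exceeds
f 0: after the last time t with f t <= f 0 it would first stay below m, hence not
increase. *)
Lemma nonincreasing_below (f df : R -> R) (s m : R) : 0 <= s ->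
  (forall r, 0 <= r <= s -> is_derive r (1 : R) f (df r)) ->
  f 0 < m -> (forall r, 0 <= r <= s -> f r < m -> df r <= 0) ->
  forall r, 0 <= r <= s -> f r <= f 0.
Proof.
move=> s0 hf f0m hd r1 /andP[r10 r1s]; rewrite leNgt; apply/negP => fr1.
have cf r : 0 <= r <= s -> {for r, continuous f} by move=> /hf; exact: is_derive_continuous.
pose S : set R := [set r | 0 <= r <= r1 /\ f r <= f 0].
have S0 : S 0 by split; rewrite ?lexx.
have hs : has_sup S by split; [exists 0|exists r1 => r [/andP[]]].
set t := sup S.
have t0 : 0 <= t by apply: sup_upper_bound.
have tr1 : t <= r1 by apply: ge_sup; [exists 0|move=> r [/andP[]]].
have tin : 0 <= t <= s by rewrite t0 (le_trans tr1).
have ft : f t <= f 0.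
  rewrite leNgt; apply/negP => ft.
  have e0 : 0 < f t - f 0 by rewrite subr_gt0.
  have [d d0 hdd] := (continuous_deltaP _ _).1 (cf t tin) _ e0.
  have [r Sr tr] := sup_adherent d0 hs.
  have rt : r <= t by apply: sup_upper_bound.
  have : `|r - t| < d by rewrite ltr_norml; rewrite -/t in tr; lra.
  by move=> /hdd; case: Sr => _ fr; rewrite ltr_norml; lra.
have tr1' : t < r1 by rewrite lt_neqAle tr1 andbT; apply/eqP => E; rewrite E in ft; lra.
have up r : t < r -> r <= r1 -> f 0 < f r.
  move=> tr rr; rewrite ltNge; apply/negP => fr.
  have : r <= t by apply: sup_upper_bound => //; split; rewrite ?(le_trans t0) ?(ltW tr)//.
  by rewrite leNgt tr.
have e0 : 0 < m - f t by lra.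
have [d d0 hdd] := (continuous_deltaP _ _).1 (cf t tin) _ e0.
set b := Num.min r1 (t + d / 2).
have tb : t < b by rewrite lt_min tr1' ltrDl divr_gt0.
have br1 : b <= r1 by rewrite ge_min lexx.
have bd : b <= t + d / 2 by rewrite ge_min lexx orbT.
have := up b tb br1.
have : f b <= f t.
  apply: (@nonincreasing_bound f df) => [|x xb|x xb]; first exact: ltW.
  - by apply: hf; lra.
  - apply: hd; first by lra.
    by have /hdd : `|x - t| < d; rewrite ltr_norml; lra.
lra.
Qed.

Lemma is_derive_sqn (u du : R -> C) (r : R) : is_derive r (1 : R) u (du r) ->
  is_derive r (1 : R) (fun x => sqn (u x)) (2 * ((u r).1 * (du r).1 + (u r).2 * (du r).2)).
Proof.
move=> h; have h1 := is_derive_fst h; have h2 := is_derive_snd h.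
have := is_deriveD (is_deriveX 2 h1) (is_deriveX 2 h2).
move=> H; apply: (is_derive_eq H).
by rewrite /= !expr1 /GRing.scale/=; ring.
Qed.

Lemma is_derive_mull (a r : R) : is_derive r (1 : R) (fun x => a * x) a.
Proof.
have H : is_derive r (1 : R) (fun x : R => a *: x) (a *: (1 : R)) :=
  is_deriveZ a (is_derive_id r (1 : R)).
by rewrite /GRing.scale/= mulr1 in H.
Qed.

Lemma is_derive_scalel (r : R) p : is_derive r (1 : R) (fun x : R => x *: p) p.
Proof.
have H := is_derive_pair (is_derive_mull p.1 r) (is_derive_mull p.2 r).
have -> : (fun x : R => x *: p) = (fun x : R => (p.1 * x, p.2 * x)).
  by apply/funext => x; rewrite scale_pair ![_ * x]mulrC.
by case: p H.
Qed.

Lemma is_derive_expRM (a r : R) : is_derive r (1 : R) (fun x => expR (a * x)) (a * expR (a * r)).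
Proof.
have := @is_derive1_comp _ expR (fun x => a * x) r (expR (a * r)) a (is_derive_expR _)
  (is_derive_mull a r).
by rewrite mulrC.
Qed.

(** The growth bound is only assumed while u stays in the ball of radius rho, and the
smallness of u 0 guarantees that it never leaves it.  The function
sqn (u r) * exp (- 4 K r) is nonincreasing, and the factor 2 absorbs the
comparison of sqn with the sup norm. *)
Lemma gronwall (u du : R -> C) (s K rho : R) : 0 <= s -> 0 <= K -> 0 < rho ->
  (forall r, 0 <= r <= s -> is_derive r (1 : R) u (du r)) ->
  (forall r, 0 <= r <= s -> `|u r| < rho -> `|du r| <= K * `|u r|) ->
  2 * expR (4 * K * s) * `|u 0| < rho ->
  forall r, 0 <= r <= s -> `|u r| <= 2 * expR (4 * K * s) * `|u 0|.
Proof.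
move=> s0 K0 rho0 hu hK small.
set E := expR (4 * K * s); have E1 : 1 <= E by rewrite -expR0 ler_expR !mulr_ge0.
have E0 : 0 < E by lra.
pose phi r := sqn (u r) * expR (- (4 * K) * r).
pose dphi r := sqn (u r) *: (- (4 * K) * expR (- (4 * K) * r)) + expR (- (4 * K) * r) *: (2 * ((u
  r).1 * (du r).1 + (u r).2 * (du r).2)).
have hphi r : 0 <= r <= s -> is_derive r (1 : R) phi (dphi r).
  move=> /hu /is_derive_sqn h; exact: (is_deriveM h (is_derive_expRM _ _)).
have phi0 : phi 0 = sqn (u 0) by rewrite /phi mulr0 expR0 mulr1.
have Er r : 0 <= r <= s -> E^-1 <= expR (- (4 * K) * r).
  move=> /andP[r0 rs]; rewrite /E -expRN ler_expR mulNr lerN2 ler_wpM2l ?mulr_ge0//.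
have normu r : sqn (u r) < rho ^+ 2 -> `|u r| < rho.
  move=> h; have := le_lt_trans (norm_sqn (u r)) h.
  by rewrite ltr_pXn2r// ?nnegrE// ltW.
have u0 : sqn (u 0) < rho ^+ 2 / E.
  apply: (le_lt_trans (sqn_norm _)).
  rewrite ltr_pdivlMr//.
  have [->|un0] := eqVneq `|u 0| 0; first by rewrite expr0n/= mulr0 mul0r exprn_gt0.
  have un : 0 < `|u 0| by rewrite lt_neqAle eq_sym un0 /=.
  have : (2 * E * `|u 0|) ^+ 2 < rho ^+ 2 by rewrite ltr_pXn2r// ?nnegrE ?ltW// !mulr_gt0.
  apply: le_lt_trans; rewrite -subr_ge0.
  have -> : (2 * E * `|u 0|) ^+ 2 - 2 * `|u 0| ^+ 2 * E = 2 * E * `|u 0| ^+ 2 * (2 * E - 1) by ring.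
  by rewrite !mulr_ge0// ?ltW//; lra.
have bar r : 0 <= r <= s -> phi r <= phi 0.
  apply: (@nonincreasing_below phi dphi s (rho ^+ 2 / E) s0 hphi); first by rewrite phi0.
  move=> {}r rs; rewrite /phi => h.
  have hsquare : sqn (u r) < rho ^+ 2.
    have : sqn (u r) / E <= sqn (u r) * expR (- (4 * K) * r) by rewrite ler_wpM2l ?sqn_ge0// Er.
    by move=> /le_lt_trans /(_ h); rewrite ltr_pM2r// invr_gt0.
  have h1 := hK r rs (normu _ hsquare).
  rewrite /dphi /GRing.scale/=; set e := expR _; have e0 : 0 < e by exact: expR_gt0.
  have -> : sqn (u r) * (- (4 * K) * e) + e * (2 * ((u r).1 * (du r).1 + (u r).2 * (du r).2)) =
    2 * e * ((u r).1 * (du r).1 + (u r).2 * (du r).2 - 2 * (K * sqn (u r))) by ring.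
  rewrite mulr_ge0_le0//; first by rewrite mulr_ge0// ltW.
  rewrite subr_le0.
  have h2 (x y : R) : `|x| <= `|u r| -> `|y| <= `|du r| -> x * y <= K * sqn (u r).
    move=> hx hy; rewrite (le_trans (ler_norm _))// normrM.
    apply: (le_trans (ler_pM _ _ hx hy)) => //.
    apply: (le_trans (ler_wpM2l (normr_ge0 _) h1)).
    rewrite mulrCA -expr2 ler_wpM2l//; exact: norm_sqn.
  by have := h2 _ _ (norm1_le _) (norm1_le _); have := h2 _ _ (norm2_le _) (norm2_le _); lra.
move=> r rs; have := bar r rs; rewrite phi0 /phi => h.
have h1 : sqn (u r) <= sqn (u 0) * E.
  rewrite -ler_pdivrMr//; apply: le_trans h.
  by rewrite ler_wpM2l ?sqn_ge0// Er.
have h2 : `|u r| ^+ 2 <= (2 * E * `|u 0|) ^+ 2.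
  apply: (le_trans (norm_sqn _)); apply: (le_trans h1).
  apply: (le_trans (ler_wpM2r (ltW E0) (sqn_norm _))); rewrite -subr_ge0.
  have -> : (2 * E * `|u 0|) ^+ 2 - 2 * `|u 0| ^+ 2 * E = 2 * E * `|u 0| ^+ 2 * (2 * E - 1) by ring.
  by rewrite !mulr_ge0// ?ltW//; lra.
by rewrite ler_pXn2r// ?nnegrE ?mulr_ge0// ltW in h2.
Qed.

(** * Holomorphic vector fields and their flows *)

(** Under the Cauchy-Riemann equations the derivative along the first axis is the
complex derivative. *)
Definition cderive (f : C -> C) (x : C) : C := 'D_((1, 0) : C) f x.

Section CauchyRiemann.
Variables (U : set C) (X : C -> C).
Hypotheses (XC1 : C1_on U X) (XCR : cauchy_riemann_on U X).

Lemma derive_cauchy_riemann x v : U x -> is_derive x v X (cmul (cderive X x) v).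
Proof.
move=> Ux; have dX : differentiable X x by case: XC1 => + _; apply.
have D w : is_derive x w X ('d X x w).
  by apply: DeriveDef; [exact: diff_derivable|rewrite deriveE].
apply: (is_derive_eq (D v)).
have vE : v = v.1 *: ((1, 0) : C) + v.2 *: ((0, 1) : C).
  by rewrite !scale_pair; apply: pair_ext => /=; ring.
rewrite {1}vE linearD !linearZ/=.
have [] := XCR Ux; rewrite /partial /basis_vec/=.
have p1 w : 'D_w (fun p => (X p).1) x = ('d X x w).1 by have [_] := is_derive_fst (D w).
have p2 w : 'D_w (fun p => (X p).2) x = ('d X x w).2 by have [_] := is_derive_snd (D w).
rewrite !p1 !p2 /cderive deriveE// !scale_pair /cmul => h1 h2.
set a := 'd X x (1, 0) in h1 h2 *; set b := 'd X x (0, 1) in h1 h2 *.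
have b1 : b.1 = - a.2 by lra.
have b2 : b.2 = a.1 by lra.
by apply: pair_ext => /=; rewrite ?b1 ?b2; ring.
Qed.

Lemma cderive_continuous x : U x -> {for x, continuous (cderive X)}.
Proof. by case: XC1 => _ h Ux; exact: h. Qed.

End CauchyRiemann.

(** The derivative dX is carried along explicitly so that the notion is stable under
X |-> - X, that is, under reversal of time. *)
Definition holomorphic_on (U : set C) (X dX : C -> C) :=
  (forall x v, U x -> is_derive x v X (cmul (dX x) v)) /\ (forall x, U x -> {for x, continuous dX}).

Lemma cauchy_riemann_holomorphic (U : set C) (X : C -> C) : C1_on U X -> cauchy_riemann_on U X ->
  holomorphic_on U X (cderive X).
Proof.
by move=> XC1 XCR; split => [x v Ux|x Ux]; [exact: derive_cauchy_riemann XC1 XCR _ _ Ux|exact: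
  cderive_continuous XC1 _ Ux].
Qed.

Section Holomorphic.
Variables (U : set C) (X dX : C -> C).
Hypotheses (oU : open U) (XdX : holomorphic_on U X dX).

(** Mean value theorem for t |-> X (q + t (p - q)) - t dX(x) (p - q). *)
Lemma holomorphic_strict_cdiff x : U x -> strict_cdiff X (dX x) x.
Proof.
move=> Ux e e0; have [d1 d10 hd1] := (open_deltaP _).1 oU x Ux.
have e2 : 0 < e / 2 by rewrite divr_gt0.
have [d2 d20 hd2] := (continuous_deltaP _ _).1 (XdX.2 _ Ux) _ e2.
exists (Num.min d1 d2); first by rewrite lt_min d10.
move=> p q px qx; set v := p - q; set a := dX x.
have seg (t : R) : 0 <= t <= 1 -> `|q + t *: v - x| < Num.min d1 d2.
  move=> /andP[t0 t1]; have -> : q + t *: v - x = t *: (p - x) + (1 - t) *: (q - x).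
    by rewrite !scale_pair; apply: pair_ext => /=; ring.
  rewrite (le_lt_trans (ler_normD _ _))// !normrZ !ger0_norm ?subr_ge0//.
  set M := Num.max `|p - x| `|q - x|.
  have Mlt : M < Num.min d1 d2 by rewrite gt_max px.
  apply: le_lt_trans Mlt; have -> : M = t * M + (1 - t) * M by ring.
  by rewrite lerD// ler_wpM2l ?subr_ge0// le_max lexx ?orbT.
pose phi t : C := X (q + t *: v) - t *: cmul a v.
pose dphi t : C := cmul (dX (q + t *: v) - a) v.
have hphi (t : R) : 0 <= t <= 1 -> is_derive t (1 : R) phi (dphi t).
  move=> /seg; rewrite lt_min => /andP[s1 _].
  have h1 := is_derive_line (XdX.1 _ v (hd1 _ s1)).
  have h2 := is_derive_scalel t (cmul a v).
  by have := is_deriveB h1 h2; rewrite -cmulBl.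
have bound (t : R) : 0 <= t <= 1 -> `|dphi t| <= e * `|v|.
  move=> /seg; rewrite lt_min => /andP[_ /hd2 s2].
  rewrite (le_trans (norm_cmul _ _))// ler_wpM2r//.
  by rewrite -/a in s2; lra.
have -> : X p - X q - cmul a v = phi 1 - phi 0.
  rewrite /phi scale1r !scale0r addr0 subr0 scale1r /v addrCA subrr addr0.
  by rewrite addrAC.
rewrite norm_le; apply/andP; split.
- have := @mean_value_bound (fun t => (phi t).1) (fun t => (dphi t).1) 0 1 (e * `|v|) ler01.
  rewrite subr0 mulr1; apply => t ht; first exact: is_derive_fst (hphi t ht).
  exact: le_trans (norm1_le _) (bound t ht).
- have := @mean_value_bound (fun t => (phi t).2) (fun t => (dphi t).2) 0 1 (e * `|v|) ler01.
  rewrite subr0 mulr1; apply => t ht; first exact: is_derive_snd (hphi t ht).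
  exact: le_trans (norm2_le _) (bound t ht).
Qed.

Lemma segment_bounded (W : normedModType R) (f : R -> W) (s : R) :
  (forall r, 0 <= r <= s -> {for r, continuous f}) ->
  exists2 M : R, 0 < M & forall r, 0 <= r <= s -> `|f r| <= M.
Proof.
move=> cf; have cK : compact (f @` `[0, s]%classic).
  apply: continuous_compact; last exact: segment_compact.
  by apply: continuous_in_subspaceT => r; rewrite inE/= in_itv/=; exact: cf.
have [M [_ /(_ (`|M| + 1))]] := compact_bounded cK.
move=> /(_ (ltac:(by rewrite (le_lt_trans (ler_norm _))// ltrDl))) hM.
exists (`|M| + 1); first by rewrite ltr_wpDl.
by move=> r rs; apply: hM; exists r => //=; rewrite in_itv.
Qed.

Section Curve.
Variables (a b : R) (g : R -> C).
Hypothesis gX : integral_curve U X a b g.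

Lemma curve_continuous r : a < r < b -> {for r, continuous g}.
Proof. by move=> /gX[_]; exact: is_derive_continuous. Qed.

Lemma derivative_curve_continuous r : a < r < b -> {for r, continuous (fun x => dX (g x))}.
Proof.
move=> rab; apply: (continuous_comp (curve_continuous rab)).
by apply: XdX.2; case: (gX rab).
Qed.

(** Strict differentiability is uniform along a compact arc of an integral curve. *)
Lemma curve_uniform_strict_cdiff (s e : R) : a < 0 -> s < b -> 0 < e ->
  exists2 rho : R, 0 < rho & forall r p q, 0 <= r <= s -> `|p - g r| < rho -> `|q - g r| < rho ->
   `|X p - X q - cmul (dX (g r)) (p - q)| <= e * `|p - q|.
Proof.
move=> a0 sb e0.
have /compact_near_coveringP /(_ R (0:R)^'+ (fun rho r => forall p q, `|p - g r| < rho ->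
  `|q - g r| < rho ->
   `|X p - X q - cmul (dX (g r)) (p - q)| <= e * `|p - q|)) := @segment_compact R 0 s.
case.
  move=> r; rewrite /= in_itv/= => rs.
  have rab : a < r < b by lra.
  have [Ur _] := gX rab.
  have e2 : 0 < e / 2 by rewrite divr_gt0.
  have e4 : 0 < e / 4 by rewrite divr_gt0.
  have [d d0 hd] := holomorphic_strict_cdiff Ur e2.
  have d2 : 0 < d / 2 by rewrite divr_gt0.
  have [d3 d30 hd3] := (continuous_deltaP _ _).1 (curve_continuous rab) _ d2.
  have [d4 d40 hd4] := (continuous_deltaP _ _).1 (derivative_curve_continuous rab) _ e4.
  exists ([set t | `|t - r| < Num.min d3 d4], [set rho | rho < d / 2]) => /=.
    split; first by apply/nbhs_deltaP; exists (Num.min d3 d4) => //; rewrite lt_min d30.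
    by apply: nbhs_right_lt.
  move=> [t rho] /= [+ rd] p q pt qt; rewrite lt_min => /andP[/hd3 t3 /hd4 t4].
  have h1 : `|p - g r| < d by rewrite (le_lt_trans (ler_distD (g t) _ _))//; lra.
  have h2 : `|q - g r| < d by rewrite (le_lt_trans (ler_distD (g t) _ _))//; lra.
  have h3 := hd _ _ h1 h2.
  rewrite -(subrKA (cmul (dX (g r)) (p - q))) -cmulBl.
  rewrite (le_trans (ler_normD _ _))//.
  have h4 : `|cmul (dX (g r) - dX (g t)) (p - q)| <= e / 2 * `|p - q|.
    rewrite (le_trans (norm_cmul _ _))// ler_wpM2r//.
    by rewrite distrC; lra.
  by lra.
move=> rho /= rho0 h; exists (rho / 2); first by rewrite divr_gt0.
move=> r p q rs; apply: (h (rho / 2)) => //=.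
- by rewrite sub0r normrN gtr0_norm ?divr_gt0//; lra.
- by rewrite divr_gt0.
Qed.

End Curve.

(** Gronwall with vanishing initial difference. *)
Lemma integral_curve_unique a b (s : R) g1 g2 : integral_curve U X a b g1 ->
  integral_curve U X a b g2 ->
  a < 0 -> 0 <= s -> s < b -> g1 0 = g2 0 -> g1 s = g2 s.
Proof.
move=> h1 h2 a0 s0 sb g0.
have [rho rho0 hrho] := curve_uniform_strict_cdiff h1 a0 sb ltr01.
have [M M0 hM] := segment_bounded (fun r (rs : 0 <= r <= s) =>
  derivative_curve_continuous h1 (ltac:(lra) : a < r < b)).
have := @gronwall (fun r => g2 r - g1 r) (fun r => X (g2 r) - X (g1 r)) s (2 * M + 1) rho s0.
rewrite g0 subrr normr0 mulr0 => /(_ _ rho0) H; apply/esym/eqP; rewrite -subr_eq0 -normr_le0.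
apply: H => //; first by rewrite addr_ge0// mulr_ge0// ltW.
- by move=> r rs; have [_ D1] := h1 r (ltac:(lra)); have [_ D2] := h2 r (ltac:(lra));
  exact: is_deriveB.
- move=> r rs /(hrho r _ (g1 r) rs); rewrite subrr normr0 => /(_ rho0) h.
  rewrite -(subrK (cmul (dX (g1 r)) (g2 r - g1 r)) (X _ - _)) (le_trans (ler_normD _ _))//.
  rewrite mulrDl addrC lerD// (le_trans (norm_cmul _ _))// ler_wpM2r// ler_wpM2l//.
  exact: hM.
- by rewrite s0 lexx.
Qed.

Lemma curve_antiderivative (f : R -> R) (a b s : R) : a < 0 -> 0 <= s -> s < b ->
  (forall r, a < r < b -> {for r, continuous f}) ->
  exists F : R -> R, forall r, 0 <= r <= s -> is_derive r (1 : R) F (f r).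
Proof.
move=> a0 s0 sb cf; pose F x := (\int[lebesgue_measure]_(t in `[(a / 2)%R, x]) f t)%R;
  exists F => r rs.
have cr : {for r, continuous f} by apply: cf; lra.
have fi : lebesgue_measure.-integrable `[(a / 2)%R, ((s + b) / 2)%R]%classic (EFin \o f).
  apply: continuous_compact_integrable; first exact: segment_compact.
  by apply: continuous_in_subspaceT => x; rewrite inE/= in_itv/= => ?; apply: cf; lra.
have xu : r < (s + b) / 2 by lra.
have ax : a / 2 < r by lra.
have [D E] : derivable F r 1 /\ derive1 F r = f r := continuous_FTC1_closed xu fi ax cr.
by rewrite derive1E in E; exact: DeriveDef D E.
Qed.

Lemma flow_rel_fun s t p q : 0 <= s -> flow_rel U X s t p -> flow_rel U X s t q -> p = q.
Proof.
move=> s0 [a1 [b1 [g1 [/andP[a10 b10] /andP[a1s sb1] h1 g10 <-]]]].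
move=> [a2 [b2 [g2 [/andP[a20 b20] /andP[a2s sb2] h2 g20 <-]]]].
have S g (a b : R) : integral_curve U X a b g -> a <= Num.max a1 a2 -> Num.min b1 b2 <= b ->
    integral_curve U X (Num.max a1 a2) (Num.min b1 b2) g.
  move=> h ha hb r /andP[r1 r2]; apply: h.
  by rewrite (le_lt_trans ha r1) (lt_le_trans r2 hb).
apply: (integral_curve_unique (S _ _ _ h1 _ _) (S _ _ _ h2 _ _)) => //.
- by rewrite le_max lexx.
- by rewrite ge_min lexx.
- by rewrite le_max lexx orbT.
- by rewrite ge_min lexx orbT.
- by rewrite gt_max a10.
- by rewrite lt_min sb1.
- by rewrite g10.
Qed.

Lemma flowP s t : flow_defined U X s t -> flow_rel U X s t (flow U X s t).
Proof.
by move=> [p hp]; rewrite /flow; case: xgetP => [q _ //|/(_ p)]; case.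
Qed.

(** Let g be the curve issued from t and k = exp (- int dX(g)), so that
k' = - dX(g) k.  For two neighbouring curves with difference u, uniform strict
differentiability gives u' = dX(g) u + o(u), hence (k u)' = o(u) and
u s = k(s)^-1 k(0) u(0) + o(u(0)). *)
Lemma flow_strict_cdiff_ge0 (s : R) (w : set C) t : 0 <= s -> open w -> (forall t, w t ->
  flow_defined U X s t) -> w t ->
  exists c, c != 0 /\ strict_cdiff (flow U X s) c t.
Proof.
move=> s0 ow wdef wt.
have [a [b [g [/andP[a0 b0] /andP[as_ sb] gX g0 gs]]]] := flowP (wdef t wt).
have cD r : 0 <= r <= s -> {for r, continuous (fun x => dX (g x))}.
  by move=> rs; apply: (derivative_curve_continuous gX); lra.
have [M M0 hM] := segment_bounded cD.
have [F hF] := curve_antiderivative (f := fun r => (dX (g r)).1) a0 s0 sb (fun r rab =>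
  continuous_comp (derivative_curve_continuous gX rab) (@cvg_fst _ _ _ _ _)).
have [H hH] := curve_antiderivative (f := fun r => (dX (g r)).2) a0 s0 sb (fun r rab =>
  continuous_comp (derivative_curve_continuous gX rab) (@cvg_snd _ _ _ _ _)).
(* F and H are antiderivatives of the real and imaginary parts of dX(g) *)
pose k r : C := (expR (- F r) * cos (H r), - (expR (- F r) * sin (H r))).
have sqnk r : sqn (k r) = expR (- F r) ^+ 2.
  by rewrite /sqn /k/= sqrrN !exprMn -mulrDr cos2Dsin2 mulr1.
have k0 r : k r != 0 by rewrite -sqn_eq0 sqnk lt0r_neq0// exprn_gt0// expR_gt0.
have hk r : 0 <= r <= s -> is_derive r (1 : R) k (- cmul (dX (g r)) (k r)).
  move=> rs; have dF := hF r rs; have dH := hH r rs.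
  have de := @is_derive1_comp _ expR (fun x => - F x) r _ _ (is_derive_expR (- F r))
    (is_deriveN dF).
  have dc := @is_derive1_comp _ cos H r _ _ (is_derive_cos (H r)) dH.
  have ds := @is_derive1_comp _ sin H r _ _ (is_derive_sin (H r)) dH.
  have := is_derive_pair (is_deriveM de dc) (is_deriveN (is_deriveM de ds)).
  move=> D; apply: (is_derive_eq D).
  by rewrite /k /cmul /GRing.scale/=; apply: pair_ext => /=; ring.
have [B B0 hB] := segment_bounded (fun r rs => is_derive_continuous (hk r rs)).
exists (cmul (cinv (k s)) (k 0)); split.
  by rewrite -sqn_eq0 sqn_cmul mulf_neq0 ?sqn_eq0 ?cinv_neq0.
move=> e e0.
set A := 2 * expR (4 * (2 * M + 1) * s).
have A0 : 0 < A by rewrite mulr_gt0// expR_gt0.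
set m := `|cinv (k s)|; have m0 : 0 < m by rewrite normr_gt0 cinv_neq0.
(* e / Q is the relative error needed on the field along g *)
set Q : R := 2 * m * (2 * B * A * (s + 1)).
have s10 : 0 < s + 1 by rewrite ltr_wpDl.
have Q0 : 0 < Q by rewrite !mulr_gt0 ?expR_gt0.
have eQ : 0 < Num.min 1 (e / Q) by rewrite lt_min ltr01 divr_gt0.
have [rho rho0 hrho] := curve_uniform_strict_cdiff gX a0 sb eQ.
have [d1 d10 hd1] := (open_deltaP _).1 ow t wt.
exists (Num.min d1 (rho / A)); first by rewrite lt_min d10 divr_gt0.
have lipM r p q : 0 <= r <= s -> `|p - g r| < rho -> `|q - g r| < rho ->
  `|X p - X q| <= (2 * M + 1) * `|p - q|.
  move=> rs pr qr; have h := hrho r p q rs pr qr.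
  rewrite -(subrK (cmul (dX (g r)) (p - q)) (X p - X q)) (le_trans (ler_normD _ _))//.
  rewrite mulrDl addrC lerD//.
    by rewrite (le_trans (norm_cmul _ _))// ler_wpM2r// ler_wpM2l// hM.
  by rewrite (le_trans h)// ler_wpM2r// ge_min lexx.
have near p : `|p - t| < Num.min d1 (rho / A) -> exists gp, [/\ gp 0 = p, gp s = flow U X s p,
    forall r, 0 <= r <= s -> is_derive r (1 : R) gp (X (gp r)) &
    forall r, 0 <= r <= s -> `|gp r - g r| < rho].
  rewrite lt_min => /andP[/hd1 wp pA].
  have [a' [b' [gp [/andP[a'0 b'0] /andP[a's sb'] gpX gp0 gps]]]] := flowP (wdef p wp).
  have dgp r : 0 <= r <= s -> is_derive r (1 : R) gp (X (gp r)).
    by move=> rs; have [] := gpX r (ltac:(lra)).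
  have dg r : 0 <= r <= s -> is_derive r (1 : R) g (X (g r)).
    by move=> rs; have [] := gX r (ltac:(lra)).
  exists gp; split => // r rs.
  have sm : A * `|gp 0 - g 0| < rho by rewrite gp0 g0 mulrC -ltr_pdivlMr.
  apply: le_lt_trans sm.
  have := @gronwall (fun r => gp r - g r) (fun r => X (gp r) - X (g r)) s (2 * M + 1) rho s0.
  move=> G; apply: G => //.
  - by rewrite addr_ge0// mulr_ge0// ltW.
  - by move=> x xs; apply: is_deriveB; [exact: dgp|exact: dg].
  - by move=> x xs h; apply: (lipM x) => //; rewrite subrr normr0.
  - by rewrite gp0 g0 mulrC -ltr_pdivlMr.
move=> p q /near[gp [gp0 gps dgp ngp]] /near[gq [gq0 gqs dgq ngq]].
rewrite -gps -gqs; set u := fun r => gp r - gq r.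
have du r : 0 <= r <= s -> is_derive r (1 : R) u (X (gp r) - X (gq r)).
  by move=> rs; apply: is_deriveB; [exact: dgp|exact: dgq].
have uA r : 0 <= r <= s -> `|u r| <= A * `|p - q|.
  move=> rs; rewrite -gp0 -gq0.
  have := @gronwall u (fun r => X (gp r) - X (gq r)) s (2 * M + 1) (A * `|u 0| + 1) s0.
  move=> G; apply: G => //.
  - by rewrite addr_ge0// mulr_ge0// ltW.
  - by rewrite ltr_wpDl// mulr_ge0// ltW.
  - by move=> x xs _; apply: (lipM x) => //; [exact: ngp|exact: ngq].
  - by rewrite ltrDl.
set eta := fun r => X (gp r) - X (gq r) - cmul (dX (g r)) (u r).
have heta r : 0 <= r <= s -> `|cmul (k r) (eta r)| <= 2 * B * (e / Q * (A * `|p - q|)).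
  move=> rs; rewrite (le_trans (norm_cmul _ _))// ler_pM ?mulr_ge0//;
    first by rewrite ler_wpM2l// hB.
  apply: (le_trans (hrho r (gp r) (gq r) rs (ngp r rs) (ngq r rs))).
  rewrite ler_pM//; [exact: ltW|by rewrite ge_min lexx orbT|exact: uA].
have d1u r : 0 <= r <= s -> is_derive r (1 : R) (fun x => (cmul (k x) (u x)).1) (cmul (k r)
  (eta r)).1.
  move=> rs; have D1 := is_derive_fst (hk r rs); have D2 := is_derive_snd (hk r rs).
  have E1 := is_derive_fst (du r rs); have E2 := is_derive_snd (du r rs).
  have := is_deriveB (is_deriveM D1 E1) (is_deriveM D2 E2).
  by move=> D; apply: (is_derive_eq D); rewrite /eta /cmul /GRing.scale/=; ring.
have d2u r : 0 <= r <= s -> is_derive r (1 : R) (fun x => (cmul (k x) (u x)).2) (cmul (k r)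
  (eta r)).2.
  move=> rs; have D1 := is_derive_fst (hk r rs); have D2 := is_derive_snd (hk r rs).
  have E1 := is_derive_fst (du r rs); have E2 := is_derive_snd (du r rs).
  have := is_deriveD (is_deriveM D1 E2) (is_deriveM D2 E1).
  by move=> D; apply: (is_derive_eq D); rewrite /eta /cmul /GRing.scale/=; ring.
have ku : `|cmul (k s) (u s) - cmul (k 0) (u 0)| <= 2 * B * (e / Q * (A * `|p - q|)) * s.
  rewrite norm_le; apply/andP; split.
  - have := mean_value_bound s0 d1u (fun r rs => le_trans (norm1_le _) (heta r rs)).
    by rewrite subr0.
  - have := mean_value_bound s0 d2u (fun r rs => le_trans (norm2_le _) (heta r rs)).
    by rewrite subr0.
have -> : gp s - gq s - cmul (cmul (cinv (k s)) (k 0)) (p - q) = cmul (cinv (k s)) (cmul (k s)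
  (u s) - cmul (k 0) (u 0)).
  by rewrite [RHS]cmulBr cmulVK// cmulA /u gp0 gq0.
rewrite (le_trans (norm_cmul _ _))// -/m.
have m20 : 0 <= 2 * m by rewrite mulr_ge0// ltW.
apply: (le_trans (ler_wpM2l m20 ku)).
have -> : e * `|p - q| = 2 * m * (2 * B * (e / Q * (A * `|p - q|)) * (s + 1)).
  rewrite /Q; field; rewrite !lt0r_neq0//; lra.
rewrite ler_wpM2l// ler_wpM2l ?lerDl//.
by rewrite !mulr_ge0// ?invr_ge0 ltW.
Qed.

End Holomorphic.

End Calculus.

(** * Derivatives of a pulled back map *)

Section Pullback.
Variable R : realType.
Local Notation C := (R * R)%type.
Implicit Types (p q : C).
Local Notation leb := (@lebesgue_measure R).
Local Notation leb2 := (leb \x leb)%E.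

Lemma differentiable_delta (V W : normedModType R) (f : V -> W) (x : V) : differentiable f x ->
  forall e : R, 0 < e -> exists2 d : R, 0 < d & forall y, `|y - x| < d ->
    `|f y - f x - 'd f x (y - x)| <= e * `|y - x|.
Proof.
move=> df e e0; have /eqaddoP /(_ e e0) /nbhs_deltaP[d d0 hd] := diff_locally df.
exists d => // y yx; have := hd (y - x); rewrite subr0 => /(_ yx).
by rewrite -[X in `|X| <= _]/(f (y - x + x) - (f x + 'd f x (y - x))) subrK opprD addrA.
Qed.

(** Chain rule, with the differential of g being multiplication by b. *)
Lemma is_derive_comp_strict_cdiff (u : C -> R) (g : C -> C) (b y v : C) :
  differentiable u (g y) -> strict_cdiff g b y -> is_derive y v (fun p => u (g p)) ('d u (g y)
    (cmul b v)).
Proof.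
move=> du gb; apply/is_derive_cvgP; apply/cvgrPdist_le => /= e e0.
set x := g y in du *; set l := 'd u x.
set K := `|l (1, 0)| + `|l (0, 1)|.
have lK r : `|l r| <= K * `|r|.
  have rE : r = r.1 *: ((1, 0) : C) + r.2 *: ((0, 1) : C).
    by rewrite !scale_pair; apply: pair_ext => /=; ring.
  rewrite {1}rE linearD !linearZ/= (le_trans (ler_normD _ _))// !normrM mulrDl.
  by rewrite ![_ * `|l _|]mulrC lerD// ler_wpM2l// ?norm1_le ?norm2_le.
have K0 : 0 <= K by rewrite addr_ge0.
have [Kg [dg [Kg0 dg0 hg]]] := strict_cdiff_lipschitz gb.
set e2 := e / (2 * (Kg * `|v| + 1)).
have D2 : 0 < Kg * `|v| + 1 by rewrite ltr_wpDl// mulr_ge0// ltW.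
have e20 : 0 < e2 by rewrite divr_gt0// mulr_gt0.
set e3 := e / (2 * (K * `|v| + 1)).
have D3 : 0 < K * `|v| + 1 by rewrite ltr_wpDl// mulr_ge0.
have e30 : 0 < e3 by rewrite divr_gt0// mulr_gt0.
have [d2 d20 hd2] := differentiable_delta du e20.
have [d3 d30 hd3] := gb _ e30.
have [d4 d40 hd4] := (continuous_deltaP _ _).1 (strict_cdiff_continuous gb) _ d20.
set d := Num.min dg (Num.min d3 d4).
have d0 : 0 < d by rewrite !lt_min dg0 d30.
have v1 : 0 < `|v| + 1 by rewrite ltr_wpDl.
near=> h.
have h0 : h != 0 by near: h; exact: nbhs_dnbhs_neq.
have hd : `|h| < d / (`|v| + 1) by near: h; apply: dnbhs0_lt; rewrite divr_gt0.
have hp : 0 < `|h| by rewrite normr_gt0.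
set p := h *: v + y.
have py : p - y = h *: v by rewrite /p addrK.
have npy : `|p - y| = `|h| * `|v| by rewrite py normrZ.
have : `|p - y| < d.
  rewrite npy; apply: (@le_lt_trans _ _ (`|h| * (`|v| + 1))); first by rewrite ler_wpM2l// lerDl.
  by rewrite -ltr_pdivlMr.
rewrite !lt_min => /and3P[p1 p2 p3].
have yy (t : R) : 0 < t -> `|y - y| < t by rewrite subrr normr0.
have A1 := hd2 _ (hd4 _ p3); have A2 := hg _ _ p1 (yy _ dg0); have A3 := hd3 _ _ p2 (yy _ d30).
rewrite -/x in A1 A2 A3.
have -> : l (cmul b v) - h^-1 *: (u (g p) - u x) =
   - (h^-1 * ((u (g p) - u x - l (g p - x)) + l (g p - x - cmul b (p - y)))).
  have -> : l (g p - x - cmul b (p - y)) = l (g p - x) - h * l (cmul b v).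
    by rewrite linearB/= py cmulZr linearZ.
  by rewrite /GRing.scale/=; field.
rewrite normrN normrM normfV ler_pdivrMl//.
apply: (le_trans (ler_normD _ _)).
have B1 : `|u (g p) - u x - l (g p - x)| <= `|h| * (e / 2).
  apply: (le_trans A1); apply: (le_trans (ler_wpM2l (ltW e20) A2)).
  rewrite npy.
  have -> : `|h| * (e / 2) = e2 * (Kg * (`|h| * `|v|) + `|h|).
    by rewrite /e2; field; rewrite lt0r_neq0.
  by rewrite ler_wpM2l ?lerDl// ltW.
have B2 : `|l (g p - x - cmul b (p - y))| <= `|h| * (e / 2).
  apply: (le_trans (lK _)); apply: (le_trans (ler_wpM2l K0 A3)).
  rewrite npy.
  have -> : `|h| * (e / 2) = e3 * (K * (`|h| * `|v|) + `|h|).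
    by rewrite /e3; field; rewrite lt0r_neq0.
  by rewrite mulrCA ler_wpM2l ?lerDl// ltW.
by lra.
Unshelve. all: by end_near. Qed.

Lemma continuous_mx (T : topologicalType) (m n : nat) (M : T -> 'M[R]_(m, n)) (x : T) :
  (forall i j, {for x, continuous (fun t => M t i j)}) -> {for x, continuous M}.
Proof.
move=> h A [P MP PA].
have : \forall t \near x, forall ij : 'I_m * 'I_n, P ij.1 ij.2 (M t ij.1 ij.2).
  by apply: filter_forall => -[i j] /=; apply: (h i j); exact: MP.
by apply: filterS => t H; apply: PA => i j; exact: (H (i, j)).
Qed.

Lemma normc_sqr (a b : R) : Normc.normc (a +i* b)%C ^+ 2 = a ^+ 2 + b ^+ 2.
Proof. by rewrite /= sqr_sqrtr// addr_ge0// sqr_ge0. Qed.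

Section Differential.
Variables (n : nat) (A : set C) (u : C -> 'cV[R]_n).
Hypotheses (oA : open A) (uC1 : C1_on A u).

Lemma entry_is_derive (j : 'I_n) x v : A x -> is_derive x v (fun t => u t j 0) ('D_v u x j 0).
Proof.
move=> Ax; have du : derivable u x v by apply: diff_derivable; case: uC1 => + _; apply.
by apply: DeriveDef; [exact: (derivable_mxP u x v).1|rewrite derive_mx// mxE].
Qed.

Lemma du_entry x i a : A x -> du u x i a = 'D_(@basis_vec R a) u x i 0.
Proof. by move=> Ax; rewrite mxE /partial; have [_ ->] := entry_is_derive i (basis_vec R a) Ax. Qed.

Lemma du_continuous x : A x -> {for x, continuous (du u)}.
Proof.
move=> Ax; apply: continuous_mx => i a.
have c1 : {for x, continuous (fun t => 'D_(@basis_vec R a) u t i 0)}.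
  apply: (@continuous_comp _ _ _ ('D_(@basis_vec R a) u) (fun M : 'cV[R]_n =>
    M i 0) x (uC1.2 (@basis_vec R a) x Ax)).
  exact: coord_continuous.
move=> B; rewrite du_entry// => /c1 H.
have [d d0 hd] := (open_deltaP _).1 oA x Ax.
have nA : \forall t \near x, A t by apply/nbhs_deltaP; exists d.
have H' : \forall t \near x, B ('D_(@basis_vec R a) u t i 0) := H.
suff : \forall t \near x, B (du u t i a) by [].
by apply: filterS2 H' nA => t Bt At; rewrite du_entry.
Qed.

End Differential.

(** Column a of du us is the derivative of u along b times the a-th basis vector. *)
Lemma complexify_du_comp (n : nat) (A w' : set C) (u us : C -> 'cV[R]_n) (g : C -> C) (b y : C) :
  C1_on A u -> open w' -> w' y -> A (g y) -> strict_cdiff g b y -> (forall p, w' p ->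
    us p = u (g p)) ->
  complexify (du us y) = (b.1 -i* b.2)%C *: complexify (du u (g y)).
Proof.
move=> uC1 ow' wy Agy gb usE; have [d d0 hd] := (open_deltaP _).1 ow' y wy.
have near_us : \forall p \near y, w' p by apply/nbhs_deltaP; exists d.
have dE a j : du us y j a = 'D_(cmul b (basis_vec R a)) u (g y) j 0.
  rewrite mxE /partial.
  have du_j : differentiable (fun t => u t j 0) (g y).
    have -> : (fun t => u t j 0) = (fun M : 'cV[R]_n => M j 0) \o u by [].
    by apply: differentiable_comp; [case: uC1 => + _; exact|exact: differentiable_coord].
  have D : is_derive y (basis_vec R a) (fun p => us p j 0) ('d (fun t => u t j 0) (g y)
    (cmul b (basis_vec R a))).
    apply: near_eq_is_derive (is_derive_comp_strict_cdiff _ du_j gb).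
    by apply: filterS near_us => p wp; rewrite usE.
  have [_ ->] := D; rewrite -deriveE//.
  by have [_ ->] := entry_is_derive uC1 j (cmul b (basis_vec R a)) Agy.
have duE a j : du u (g y) j a = 'D_(basis_vec R a) u (g y) j 0 by apply: (du_entry uC1).
have ce (z : 'M[R]_(n, 2)) j k : complexify z j k = (z j 0 +i* z j 1)%C by rewrite mxE.
apply/matrixP => j k; rewrite [RHS]mxE !ce !dE !duE.
have dug : differentiable u (g y) by case: uC1 => + _; apply.
have lin (v : C) : 'D_v u (g y) j 0 = v.1 * 'D_(basis_vec R 0) u (g y) j 0 + v.2 * 'D_(basis_vec
  R 1) u (g y) j 0.
  have vE : v = v.1 *: (basis_vec R 0) + v.2 *: (basis_vec R 1).
    by rewrite !scale_pair /basis_vec /=; apply: pair_ext => /=; ring.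
  by rewrite !deriveE// {1}vE linearD !linearZ/= !mxE.
have b0 : cmul b (basis_vec R 0) = b by rewrite /cmul /basis_vec /= !mulr1 !mulr0 subr0 add0r;
  case: (b).
have b1 : cmul b (basis_vec R 1) = (- b.2, b.1) by rewrite /cmul /basis_vec /= !mulr1 !mulr0
  sub0r addr0.
have cE (p0 p1 q0 q1 : R) : p0 = b.1 * q0 + b.2 * q1 -> p1 = - b.2 * q0 + b.1 * q1 ->
    (p0 +i* p1)%C = (b.1 -i* b.2)%C * (q0 +i* q1)%C.
  by move=> -> ->; congr Complex; ring.
by apply: cE; [rewrite b0; exact: lin|rewrite b1; exact: lin].
Qed.

(** * Flows are conformal, for either sign of time *)

Section Flow.
Variables (U : set C) (X dX : C -> C).
Hypotheses (oU : open U) (XdX : holomorphic_on U X dX).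

Lemma holomorphic_opp : holomorphic_on U (fun x => - X x) (fun x => - dX x).
Proof.
split => [x v Ux|x Ux]; last by apply: continuousN; exact: XdX.2.
have -> : cmul (- dX x) v = - cmul (dX x) v by apply: pair_ext => /=; ring.
by apply: is_deriveN; exact: XdX.1.
Qed.

Lemma is_derive_reparam (g : R -> C) (a b r : R) (d : C) : is_derive (a + b * r) (1 : R) g d ->
  is_derive r (1 : R) (fun x => g (a + b * x)) (b *: d).
Proof.
move=> D; have D1 := is_derive_fst D; have D2 := is_derive_snd D.
have A : is_derive r (1 : R) (fun x : R => a + b * x) b.
  have := is_deriveD (is_derive_cst a r (1 : R)) (is_derive_mull b r).
  by rewrite add0r.
have E1 := @is_derive1_comp _ (fun x => (g x).1) (fun x => a + b * x) r _ _ D1 A.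
have E2 := @is_derive1_comp _ (fun x => (g x).2) (fun x => a + b * x) r _ _ D2 A.
have E := is_derive_pair E1 E2.
have -> : b *: d = (d.1 * b, d.2 * b) by rewrite scale_pair ![_ * b]mulrC.
have -> : (fun x : R => g (a + b * x)) = (fun y : R => ((g (a + b * y)).1, (g (a + b * y)).2)).
  by apply/funext => y; case: (g _).
exact: E.
Qed.

Lemma flow_rel_opp (Y : C -> C) s t p : flow_rel U Y s t p -> flow_rel U (fun x => - Y x) (- s) t p.
Proof.
move=> [a [b [g [/andP[a0 b0] /andP[as_ sb] gX g0 gs]]]].
exists (- b), (- a), (fun r => g (0 + -1 * r)); split; try (by apply/andP; split; lra).
- move=> r rab; have [Ug Dg] := gX (0 + -1 * r) (ltac:(lra)).
  by split => //; have := is_derive_reparam Dg; rewrite scaleN1r.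
- by rewrite mulr0 addr0.
- by rewrite add0r mulN1r opprK.
Qed.

Lemma flow_rel_oppE s t p : flow_rel U X s t p <-> flow_rel U (fun x => - X x) (- s) t p.
Proof.
split; first exact: flow_rel_opp.
move=> /flow_rel_opp; rewrite opprK.
by have -> : (fun x => - - X x) = X by apply/funext => x; rewrite opprK.
Qed.

(** Traversing the curve backwards; with uniqueness this makes the flow injective. *)
Lemma flow_rel_reverse (Y : C -> C) s t p : flow_rel U Y s t p -> flow_rel U (fun x => - Y x) s p t.
Proof.
move=> [a [b [g [/andP[a0 b0] /andP[as_ sb] gX g0 gs]]]].
exists (s - b), (s - a), (fun r => g (s + -1 * r)); split; try (by apply/andP; split; lra).
- move=> r rab; have [Ug Dg] := gX (s + -1 * r) (ltac:(lra)).
  by split => //; have := is_derive_reparam Dg; rewrite scaleN1r.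
- by rewrite mulr0 addr0.
- by rewrite mulN1r subrr.
Qed.

Lemma flow_oppE s : flow U X s = flow U (fun x => - X x) (- s).
Proof.
apply/funext => t; rewrite /flow; congr xget; apply/seteqP.
by split => p /=; rewrite flow_rel_oppE.
Qed.

Lemma flow_rel_unique s t p q : flow_rel U X s t p -> flow_rel U X s t q -> p = q.
Proof.
have [s0|s0] := leP 0 s; first exact: (flow_rel_fun oU XdX s0).
move=> /flow_rel_oppE h1 /flow_rel_oppE h2.
by apply: (flow_rel_fun oU holomorphic_opp _ h1 h2); rewrite oppr_ge0 ltW.
Qed.

Lemma flow_rel_flow s t p : flow_rel U X s t p -> flow U X s t = p.
Proof. by move=> h; apply: (flow_rel_unique _ h); apply: flowP; exists p. Qed.

Lemma flow_strict_cdiff s (w : set C) t : open w -> (forall t, w t -> flow_defined U X s t) ->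
  w t ->
  exists c, c != 0 /\ strict_cdiff (flow U X s) c t.
Proof.
have [s0|s0] := leP 0 s; first exact: (flow_strict_cdiff_ge0 oU XdX s0).
move=> ow wdef wt; rewrite flow_oppE; apply: (flow_strict_cdiff_ge0 oU holomorphic_opp _ ow _
  wt); first by rewrite oppr_ge0 ltW.
by move=> x /wdef[p] /flow_rel_oppE; exists p.
Qed.

End Flow.

Lemma flow_injective U (X dX : C -> C) s x y : open U -> holomorphic_on U X dX ->
  flow_defined U X s x -> flow_defined U X s y -> flow U X s x = flow U X s y -> x = y.
Proof.
move=> oU XdX /flowP/flow_rel_reverse hx /flowP/flow_rel_reverse hy E.
rewrite E in hx; exact: (flow_rel_unique oU (holomorphic_opp XdX) hx hy).
Qed.

Lemma flow_conformal U (X dX : C -> C) s (w : set C) : open U -> holomorphic_on U X dX -> open w ->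
  (forall t, w t -> flow_defined U X s t) ->
  exists g c, conformal_pair w (flow U X s @` w) (flow U X s) g c.
Proof.
move=> oU XdX ow wdef.
have /choice[c hc] : forall t, exists c, w t -> c != 0 /\ strict_cdiff (flow U X s) c t.
  move=> t; have [wt|nwt] := pselect (w t); last by exists 0.
  by have [c ?] := flow_strict_cdiff oU XdX ow wdef wt; exists c.
have [|g hg] := @conformal_pair_inj R w (flow U X s) c ow _ hc; last by exists g, c.
move=> x y wx wy; exact: (flow_injective oU XdX (wdef x wx) (wdef y wy)).
Qed.

(** * Homogeneous integrands are invariant *)

Lemma normc_conj_sqr (a b : R) : Normc.normc (a -i* b)%C ^+ 2 = sqn (a, b).
Proof. by rewrite normc_sqr sqrrN. Qed.

Lemma continuous_pairing (S T V : topologicalType) (f : S -> T) (g : S -> V) (x : S) :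
  {for x, continuous f} -> {for x, continuous g} -> {for x, continuous (fun t => (f t, g t))}.
Proof. by move=> hf hg; exact: (cvg_pair hf hg). Qed.

(** The factor |c|^-2 that homogeneity extracts from the conjugate of c^-1 cancels
the Jacobian. *)
Lemma homogeneous_invariant (n : nat) (Omega : set C) (L : C -> 'cV[R]_n -> 'M[R]_(n, 2) -> R)
    (F : 'cV[R]_n -> 'cV[R[i]]_n -> R) :
  open Omega ->
  C1_on (Omega `*` [set: 'cV[R]_n] `*` [set: 'M[R]_(n, 2)]) (fun x => L x.1.1 x.1.2 x.2) ->
  (forall t y z, Omega t -> L t y z = F y (complexify z)) ->
  (forall (lambda : R[i]) y z, F y (lambda *: z) = Normc.normc lambda ^+ 2 * F y z) ->
  conformally_invariant Omega L.
Proof.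
move=> open_Omega LC1 LF Fh U X oU _ XC1 XCR w u s us [ow _ _] [_ wO] uC1 hs usE.
have XdX := cauchy_riemann_holomorphic XC1 XCR.
have {}wO : w `<=` Omega by move=> t wt; apply: wO; exact: subset_closure.
have [wdef [_ w'O]] := hs s (ltac:(by rewrite ge_min le_max !lexx !orbT)).
have {}w'O : flow U X s @` w `<=` Omega by move=> t wt; apply: w'O; exact: subset_closure.
have [g [c fgc]] := flow_conformal oU XdX ow wdef.
set f := flow U X s in w'O fgc usE *; set w' := f @` w in w'O fgc *.
have [_ ow' fw gw hc] := fgc.
have usg p : w' p -> us p = u (g p).
  move=> wp; have [wg fg] := gw p wp.
  by rewrite -{1}fg usE//; [exact: wO|exact: wdef].
have cL (x : C * 'cV[R]_n * 'M[R]_(n, 2)) : Omega x.1.1 ->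
  {for x, continuous (fun x => L x.1.1 x.1.2 x.2)}.
  by move=> Ox; apply: differentiable_continuous; case: LC1 => + _; apply.
pose k t := L t (u t) (du u t).
have ck t : w t -> {for t, continuous k}.
  move=> /wO Ot; have cu : {for t, continuous u} by apply: differentiable_continuous;
    case: uC1 => + _; apply.
  have cdu := du_continuous open_Omega uC1 Ot.
  have cp : {for t, continuous (fun t => (t, u t, du u t) : C * 'cV[R]_n * 'M[R]_(n, 2))}.
    by apply: continuous_pairing cdu; apply: continuous_pairing cu; exact: cvg_id.
  exact: (continuous_comp cp (cL (t, u t, du u t) Ot)).
pose b y := cinv (c (g y)).
have hE y : w' y -> L y (us y) (du us y) = k (g y) * sqn (b y).
  move=> wy; have [wg fg] := gw y wy; have [c0 _ gc] := hc _ wg; rewrite fg in gc.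
  rewrite LF; last exact: w'O.
  rewrite (complexify_du_comp uC1 ow' wy (wO _ wg) gc usg) Fh usg// mulrC.
  by rewrite /k (LF _ _ _ (wO _ wg)) normc_conj_sqr -surjective_pairing.
apply: (Rintegral_change_of_variables fgc).
- move=> y wy; have [wg fg] := gw y wy; have [c0 _ gc] := hc _ wg; rewrite fg in gc.
  have cg := strict_cdiff_continuous gc.
  have [_ _ _ _ hb] := conformal_pair_sym fgc.
  have cb : {for y, continuous b}.
    by apply: (@strict_cdiff_deriv_continuous R w' g b ow' _ y wy) => x wx;
      have [_ hx _] := hb x wx.
  have ckb : {for y, continuous (fun y => k (g y) * sqn (b y))}.
    apply: continuousM; first exact: (continuous_comp cg (ck _ wg)).
    by apply: (continuous_comp cb); exact: sqn_continuous.
  move=> B; rewrite hE// => /ckb H.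
  have [d d0 hd] := (open_deltaP _).1 ow' y wy.
  have nw' : \forall t \near y, w' t by apply/nbhs_deltaP; exists d.
  have H' : \forall t \near y, B (k (g t) * sqn (b t)) := H.
  suff : \forall t \near y, B (L t (us t) (du us t)) by [].
  by apply: filterS2 H' nw' => t Bt wt; rewrite hE.
- move=> x wx; have [wf gf] := fw x wx; have [c0 _ _] := hc x wx.
  rewrite (hE (f x) wf) /b gf sqn_cinv// mulfVK// sqn_eq0//.
Qed.

End Pullback.

(** * Affine maps and small squares *)

Section Invariance.
Variable R : realType.
Local Notation C := (R * R)%type.
Implicit Types (p q : C).
Local Notation leb := (@lebesgue_measure R).
Local Notation leb2 := (leb \x leb)%E.

Section Affine.
Variable W : normedModType R.

Definition affine (w0 w1 w2 : W) p : W := w0 + p.1 *: w1 + p.2 *: w2.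
Variables w0 w1 w2 : W.

Lemma affineB p q : affine w0 w1 w2 p - affine w0 w1 w2 q = (p - q).1 *: w1 + (p - q).2 *: w2.
Proof.
have e r : affine w0 w1 w2 r = w0 + (r.1 *: w1 + r.2 *: w2) by rewrite addrA.
by rewrite !e opprD addrACA subrr add0r opprD addrACA -!scalerBl.
Qed.

Lemma is_derive_affine p v : is_derive p v (affine w0 w1 w2) (v.1 *: w1 + v.2 *: w2).
Proof.
apply/is_derive_cvgP; set l := v.1 *: w1 + _; apply/cvgrPdist_le => e e0; near=> h.
have h0 : h != 0 by near: h; exact: nbhs_dnbhs_neq.
by rewrite affineB addrK /= -!scalerA -scalerDr scalerA mulVf// scale1r subrr normr0 ltW.
Unshelve. all: by end_near. Qed.

Lemma fst_differentiable p : differentiable (fst : C -> R) p.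
Proof.
apply: (@linear_differentiable _ _ _ (fst : {linear C -> R})) => x; exact: cvg_fst.
Qed.

Lemma snd_differentiable p : differentiable (snd : C -> R) p.
Proof.
apply: (@linear_differentiable _ _ _ (snd : {linear C -> R})) => x; exact: cvg_snd.
Qed.

Lemma affine_C1 (A : set C) : C1_on A (affine w0 w1 w2).
Proof.
split => [p _|v p _].
  apply: differentiableD; last exact: differentiableZl (snd_differentiable p).
  by apply: differentiableD => //; exact: differentiableZl (fst_differentiable p).
have -> : (fun p => 'D_v (affine w0 w1 w2) p) = cst (v.1 *: w1 + v.2 *: w2).
  by apply/funext => q; have [] := is_derive_affine q v.
exact: cvg_cst.
Qed.

End Affine.

Definition osquare (x : C) (r : R) : set C := [set p | `|p - x| < r].

Lemma osquare_open x r : open (osquare x r).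
Proof.
apply/open_deltaP => p px; exists (r - `|p - x|); first by rewrite subr_gt0.
by move=> q qp; rewrite /osquare/= (le_lt_trans (ler_distD p _ _))// -ltrBrDr.
Qed.

Lemma leb2_osquare x (r : R) : 0 < r -> leb2 (osquare x r) = (4 * r ^+ 2)%:E.
Proof.
move=> r0; have -> : osquare x r = `]x.1 - r, x.1 + r[%classic `*` `]x.2 - r, x.2 + r[%classic.
  have h (a b : R) : (`|a - b| < r) = (b - r < a < b + r) by rewrite ltr_norml; lra.
  by apply/seteqP; split => p /=; rewrite /osquare/= norm_lt /= !h !in_itv/= => /andP.
rewrite product_measure1E//=.
have h (a : R) : leb `]a - r, a + r[%classic = (2 * r)%:E.
  rewrite lebesgue_measure_itv/= lte_fin; case: ltP => [_|h]; first by rewrite -EFinB;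
    congr EFin; ring.
  by congr EFin; lra.
by rewrite !h -EFinM; congr EFin; ring.
Qed.

Lemma csquare_closed (x : C) (r : R) : closed (csquare x r).
Proof. by apply: compact_closed; [exact: norm_hausdorff|exact: compact_csquare]. Qed.

(** Closed squares are compact and closed, hence contain the closure of A. *)
Lemma relatively_compact_sub_csquare (A Omega : set C) x r : A `<=` csquare x r ->
  csquare x r `<=` Omega ->
  relatively_compact_in A Omega.
Proof.
move=> Asq sqO; have clA : closure A `<=` csquare x r.
  by rewrite [csquare x r](closure_id _).1; [exact: closureS|exact: csquare_closed].
split; last by move=> p /clA /sqO.
by apply: (subclosed_compact _ (@compact_csquare R x r)) => //; exact: closed_closure.
Qed.

Lemma osquare_domain x (r : R) : 0 < r -> domain (osquare x r).
Proof.
move=> r0; have cx : osquare x r x by rewrite /osquare/= subrr normr0.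
split; [exact: osquare_open|by exists x|].
pose seg (p : C) : set C := (fun t : R => x + t *: (p - x)) @` `[0, 1]%classic.
have -> : osquare x r = \bigcup_(p in osquare x r) seg p.
  apply/seteqP; split => [p xp|q [p xp [t t01 <-]]].
    by exists p => //; exists 1; rewrite /= ?in_itv/= ?ler01 ?lexx// scale1r addrC subrK.
  move: t01; rewrite /= in_itv/= => /andP[t0 t1]; rewrite /osquare/= addrC addKr normrZ ger0_norm//.
  by rewrite (le_lt_trans _ xp)// ler_piMl.
apply: bigcup_connected.
  by exists x => p _; exists 0; rewrite /= ?in_itv/= ?ler01 ?lexx// scale0r addr0.
move=> p _; apply: connected_continuous_connected; first exact: segment_connected.
apply: continuous_subspaceT => t; apply: cvgD; first exact: cvg_cst.
exact: is_derive_continuous (is_derive_scalel t (p - x)).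
Qed.

Lemma small_square_average (A : C -> R) (V : set C) (x : C) (e : R) : open V -> V x ->
  (forall p, V p -> {for p, continuous A}) -> 0 < e ->
  exists2 r0 : R, 0 < r0 & forall r, 0 < r < r0 ->
    `|(\int[leb2]_(p in osquare x r) A p)%R - A x * (4 * r ^+ 2)| <= e * (4 * r ^+ 2).
Proof.
move=> oV Vx cA e0; have [d1 d10 hd1] := (open_deltaP _).1 oV x Vx.
have [d2 d20 hd2] := (continuous_deltaP _ _).1 (cA x Vx) e e0.
exists (Num.min d1 d2); first by rewrite lt_min d10.
move=> r; rewrite lt_min => /andP[r0 /andP[r1 r2]].
have mO : measurable (osquare x r : set (measurableTypeR R * measurableTypeR R)) by apply:
  open_measurable2; exact: osquare_open.
have muO : leb2 (osquare x r) = (4 * r ^+ 2)%:E by exact: leb2_osquare.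
have finO : (leb2 (osquare x r) < +oo)%E by rewrite muO ltry.
have near p : osquare x r p -> `|A p - A x| < e by move=> xp; apply: hd2; exact: lt_trans xp r2.
have icst (k : R) : leb2.-integrable (osquare x r) (EFin \o cst k).
  apply: measurable_bounded_integrable => //; exists `|k|; split; first exact: num_real.
  by move=> M kM p _; exact: ltW.
have iA : leb2.-integrable (osquare x r) (EFin \o A).
  apply: measurable_bounded_integrable => //.
    apply: continuous_measurable2; first exact: osquare_open.
    by move=> p xp; apply: cA; apply: hd1; exact: lt_trans xp r1.
  exists (`|A x| + e); split; first exact: num_real.
  move=> M kM p xp; apply: ltW; apply: le_lt_trans kM.
  by rewrite -[A p](subrK (A x)) (le_trans (ler_normD _ _))// addrC lerD2l ltW// near.
have cE k : (\int[leb2]_(p in osquare x r) cst k p)%R = k * (4 * r ^+ 2).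
  have -> : (\int[leb2]_(p in osquare x r) cst k p)%R = fine (\int[leb2]_(p in osquare x r) cst
    k%:E p)%E by [].
  rewrite integral_cst//.
  transitivity (fine (k%:E * leb2 (osquare x r))%E); [by []|by rewrite muO].
have lo : (A x - e) * (4 * r ^+ 2) <= (\int[leb2]_(p in osquare x r) A p)%R.
  rewrite -cE; apply: le_Rintegral => // p /near; rewrite ltr_norml/=; lra.
have hi : (\int[leb2]_(p in osquare x r) A p)%R <= (A x + e) * (4 * r ^+ 2).
  rewrite -cE; apply: le_Rintegral => // p /near; rewrite ltr_norml/=; lra.
rewrite ler_norml lerBrDr lerBlDr -mulNr -!mulrDl addrC [e + _]addrC.
by rewrite lo hi.
Qed.

(** The averages over small squares converge to the value at the centre. *)
Lemma eq_of_small_squares (A B : C -> R) (V : set C) (x : C) (r0 : R) : open V -> V x ->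
  (forall p, V p -> {for p, continuous A}) -> (forall p, V p -> {for p, continuous B}) -> 0 < r0 ->
  (forall r, 0 < r < r0 -> (\int[leb2]_(p in osquare x r) A p)%R = (\int[leb2]_(p in osquare x r)
    B p)%R) ->
  A x = B x.
Proof.
move=> oV Vx cA cB r00 AB; apply/eqP; rewrite -subr_eq0 -normr_le0; apply/ler_addgt0Pr => e e0.
have e2 : 0 < e / 2 by rewrite divr_gt0.
have [ra ra0 ha] := small_square_average oV Vx cA e2.
have [rb rb0 hb] := small_square_average oV Vx cB e2.
set r := Num.min r0 (Num.min ra rb) / 2.
have m0 : 0 < Num.min r0 (Num.min ra rb) by rewrite !lt_min r00 ra0.
have rp : 0 < r by rewrite divr_gt0.
have : r < Num.min r0 (Num.min ra rb) by rewrite /r; lra.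
rewrite !lt_min => /and3P[h0 h1 h2].
have Ha := ha r (ltac:(by rewrite rp h1)); have Hb := hb r (ltac:(by rewrite rp h2)).
rewrite AB ?rp ?h0// in Ha.
have r4 : 0 < 4 * r ^+ 2 by rewrite mulr_gt0// exprn_gt0.
rewrite add0r -(ler_pM2r r4) -{1}(gtr0_norm r4) -normrM mulrBl.
move: Ha Hb; move: (\int[leb2]_(p in _) _)%R (A x * _) (B x * _) => I a b.
by rewrite !ler_norml; lra.
Qed.

Lemma is_derive_cmull (e : R -> C) (de d : C) (s : R) : is_derive s (1 : R) e de ->
  is_derive s (1 : R) (fun x => cmul (e x) d) (cmul de d).
Proof.
move=> D; have D1 := is_derive_fst D; have D2 := is_derive_snd D.
have c1 := is_derive_cst (d.1 : R) s (1 : R); have c2 := is_derive_cst (d.2 : R) s (1 : R).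
have E1 := is_deriveB (is_deriveM D1 c1) (is_deriveM D2 c2).
have E2 := is_deriveD (is_deriveM D1 c2) (is_deriveM D2 c1).
have E := is_derive_pair E1 E2.
apply: (is_derive_eq E); rewrite /cmul /GRing.scale/=; apply: pair_ext => /=; ring.
Qed.

(** * Invariant integrands are homogeneous *)

Section Forward.
Variables (n : nat) (Omega : set C) (L : C -> 'cV[R]_n -> 'M[R]_(n, 2) -> R).
Hypothesis open_Omega : open Omega.
Hypothesis LC1 : C1_on (Omega `*` [set: 'cV[R]_n] `*` [set: 'M[R]_(n, 2)]) (fun x =>
  L x.1.1 x.1.2 x.2).
Hypothesis hinv : conformally_invariant Omega L.

Lemma lagrangian_continuous (f : C -> C) (u : C -> 'cV[R]_n) (z : 'M[R]_(n, 2)) (x : C) :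
  {for x, continuous f} -> {for x, continuous u} -> Omega (f x) ->
  {for x, continuous (fun t => L (f t) (u t) z)}.
Proof.
move=> cf cu Ox.
have cL : {for (f x, u x, z), continuous (fun x => L x.1.1 x.1.2 x.2)}.
  by apply: differentiable_continuous; case: LC1 => + _; apply.
have cp : {for x, continuous (fun t => (f t, u t, z) : C * 'cV[R]_n * 'M[R]_(n, 2))}.
  by apply: continuous_pairing; [exact: continuous_pairing|exact: cvg_cst].
exact: (continuous_comp cp cL).
Qed.

Lemma complexify_inj : injective (@complexify R n).
Proof.
move=> z z' /matrixP E; apply/matrixP => j a; have := E j 0; rewrite !mxE => -[E0 E1].
by case: a => -[|[|//]] ha; [move: E0|move: E1]; congr (_ = _); congr (_ j _); apply: val_inj.
Qed.

(** The affine map with value y at t0 and constant derivative z. *)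
Definition affine_map (y : 'cV[R]_n) (z : 'M[R]_(n, 2)) (t0 : C) : C -> 'cV[R]_n :=
  affine (y - (t0.1 *: col 0 z + t0.2 *: col 1 z)) (col 0 z) (col 1 z).

Lemma affine_map0 y z t0 : affine_map y z t0 t0 = y.
Proof. by rewrite /affine_map /affine -addrA subrK. Qed.

Lemma du_affine_map y z t0 t : du (affine_map y z t0) t = z.
Proof.
apply/matrixP => j a.
have C1 : C1_on setT (affine_map y z t0) by exact: affine_C1.
rewrite (du_entry C1)//.
have [_ ->] := is_derive_affine (y - (t0.1 *: col 0 z + t0.2 *: col 1 z)) (col 0 z)
  (col 1 z) t (basis_vec R a).
rewrite !mxE /basis_vec; case: a => -[|[|//]] ha /=.
  by rewrite mul1r mul0r addr0; congr (z j _); apply: val_inj.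
by rewrite mul1r mul0r add0r; congr (z j _); apply: val_inj.
Qed.

(** The field is X p = v + mu (p - t0); q is the integral curve of t0 and e is the
complex derivative of the flow.  Keeping e and q abstract covers translations
and rotation-dilations at once. *)
Section AffineFlow.
Variables (t0 v mu : C) (e q : R -> C) (r0 : R).
Hypothesis de : forall s, is_derive s (1 : R) e (cmul mu (e s)).
Hypothesis dq : forall s, is_derive s (1 : R) q (v + cmul mu (q s - t0)).
Hypotheses (e0 : e 0 = (1, 0)) (q0 : q 0 = t0) (e1 : e 1 != 0) (r00 : 0 < r0).
Hypothesis q_Omega : forall s, 0 <= s <= 1 -> csquare (q s) r0 `<=` Omega.

Let X p := v + cmul mu (p - t0).

Let Phi s t := q s + cmul (e s) (t - t0).

Let X_affine : X = affine (v - cmul mu t0) mu (- mu.2, mu.1).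
Proof.
apply/funext => p; rewrite /X /affine /cmul !scale_pair.
by apply: pair_ext => /=; ring.
Qed.

Let dX p w : is_derive p w X (cmul mu w).
Proof.
rewrite X_affine; apply: (is_derive_eq (is_derive_affine _ _ _ p w)).
by rewrite !scale_pair /cmul; apply: pair_ext => /=; ring.
Qed.

Let XC1 : C1_on setT X. Proof. by rewrite X_affine; exact: affine_C1. Qed.

Let XCR : cauchy_riemann_on setT X.
Proof.
move=> t _; rewrite /partial.
have p1 w : 'D_w (fun p => (X p).1) t = (cmul mu w).1 by have [_] := is_derive_fst (dX t w).
have p2 w : 'D_w (fun p => (X p).2) t = (cmul mu w).2 by have [_] := is_derive_snd (dX t w).
by rewrite !p1 !p2 /cmul /basis_vec /=; split; ring.
Qed.

Lemma affine_flow s t : flow_rel setT X s t (Phi s t).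
Proof.
have n0 := normr_ge0 s; have n1 := ler_norm s; have n2 := lerNnormlW (lexx `|s|).
exists (- (`|s| + 1)), (`|s| + 1), (Phi^~ t); split => //.
- by apply/andP; split; lra.
- by apply/andP; split; lra.
- move=> r _; split => //.
  have := is_deriveD (dq r) (is_derive_cmull (t - t0) (de r)).
  move=> D; apply: (is_derive_eq D); rewrite /X /Phi -addrA -cmulA -cmulDr.
  by congr (_ + cmul _ _); rewrite addrAC.
- by rewrite /Phi q0 e0 cmul1 addrC subrK.
Qed.

Let flowE s : flow setT X s = Phi s.
Proof.
apply/funext => t; apply: (flow_rel_flow openT (cauchy_riemann_holomorphic XC1 XCR)).
exact: affine_flow.
Qed.

(** Invariance for an affine u, whose transport by the affine flow is affine again
with derivative z', is an equality of integrals over all small squares around t0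
once the left-hand side is pulled back by the flow. *)
Lemma affine_flow_identity y z z' :
  complexify z' = ((cinv (e 1)).1 -i* (cinv (e 1)).2)%C *: complexify z ->
  L t0 y z = sqn (e 1) * L (q 1) y z'.
Proof.
move=> zz'; set b := cinv (e 1) in zz'.
pose u := affine_map y z t0.
pose g p := t0 + cmul b (p - q 1).
pose us p := u (g p).
have uC1 A : C1_on A u by exact: affine_C1.
have gPhi t : g (Phi 1 t) = t.
  by rewrite /g /Phi [q 1 + _]addrC addrK /b cmulVK// addrC subrK.
have sg p : strict_cdiff g b p.
  move=> eps eps0; exists 1 => // p1 p2 _ _.
  have -> : g p1 - g p2 = cmul b (p1 - p2).
    by rewrite /g opprD addrACA subrr add0r -cmulBr opprB addrA subrK.
  by rewrite subrr normr0 mulr_ge0// ltW.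
have sPhi t : strict_cdiff (Phi 1) (e 1) t.
  move=> eps eps0; exists 1 => // p1 p2 _ _.
  have -> : Phi 1 p1 - Phi 1 p2 = cmul (e 1) (p1 - p2).
    by rewrite /Phi opprD addrACA subrr add0r -cmulBr opprB addrA subrK.
  by rewrite subrr normr0 mulr_ge0// ltW.
have dus p : du us p = z'.
  apply: complexify_inj; rewrite (complexify_du_comp (uC1 setT) openT _ _ (sg p))//.
  by rewrite du_affine_map zz'.
have [M M0 hM] := segment_bounded (s := 1) (fun r _ => is_derive_continuous (de r)).
have M1 : 0 < 2 * M + 1 by rewrite addr_gt0// mulr_gt0.
(* squares of radius at most rho0 stay in Omega during the motion *)
pose rho0 := r0 / (2 * M + 1).
have rho00 : 0 < rho0 by rewrite divr_gt0.
have PhiO s t : 0 <= s <= 1 -> `|t - t0| < rho0 -> csquare (q s) r0 (Phi s t).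
  move=> s01 tt; rewrite /csquare/= /Phi addrC addKr (le_trans (norm_cmul _ _))//.
  have := hM s s01; have h := ltW tt; rewrite /rho0 ler_pdivlMr// in h.
  have := normr_ge0 (t - t0); set m := `|e s|; set d := `|_| in h *.
  move=> d0 mM; apply: le_trans h; rewrite mulrC ler_wpM2l//; lra.
have s11 : 0 <= (1 : R) <= 1 by rewrite ler01 lexx.
have s00 : 0 <= (0 : R) <= 1 by rewrite ler01 lexx.
have Phi0 t : Phi 0 t = t by rewrite /Phi q0 e0 cmul1 addrC subrK.
have osquare_Omega p : osquare t0 rho0 p -> Omega p.
  by move=> pt; have := q_Omega s00 (PhiO 0 p s00 pt); rewrite Phi0.
have cu t : {for t, continuous u}.
  by apply: differentiable_continuous; case: (uC1 setT) => + _; apply.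
have cA p : osquare t0 rho0 p -> {for p, continuous (fun t => L (Phi 1 t) (u t) z' * sqn (e 1))}.
  move=> pt; apply: continuousM; last exact: cvg_cst.
  by apply: lagrangian_continuous; [exact: strict_cdiff_continuous (sPhi p)|exact: cu|apply:
    (q_Omega s11); exact: PhiO].
have cB p : osquare t0 rho0 p -> {for p, continuous (fun t => L t (u t) z)}.
  by move=> pt; apply: lagrangian_continuous; [exact: cvg_id|exact: cu|exact: osquare_Omega].
have t0V : osquare t0 rho0 t0 by rewrite /osquare/= subrr normr0.
have := eq_of_small_squares (@osquare_open t0 rho0) t0V cA cB rho00.
have -> : Phi 1 t0 = q 1 by rewrite /Phi subrr cmul0 addr0.
rewrite /u affine_map0 -/u mulrC => E; apply/esym; apply: E => rho /andP[rho_gt0 rhor].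
have sub p : osquare t0 rho p -> osquare t0 rho0 p by move=> pt; exact: lt_trans pt rhor.
have inv : action_invariant_by Omega L setT X := hinv openT (fun _ _ => I) XC1 XCR.
have {inv} : action L (flow setT X 1 @` osquare t0 rho) us = action L (osquare t0 rho) u.
  apply: inv.
  - exact: osquare_domain.
  - apply: (relatively_compact_sub_csquare _ (q_Omega s00)) => p /sub pt.
    by have := PhiO 0 p s00 pt; rewrite Phi0.
  - exact: uC1.
  - move=> s'; rewrite min_l ?max_r ?ler01// => s'01; split.
      by move=> t _; exists (Phi s' t); exact: affine_flow.
    apply: (relatively_compact_sub_csquare _ (q_Omega s'01)); rewrite flowE => _ [t /sub pt <-].
    exact: PhiO.
  - by move=> t _ _; rewrite flowE /us gPhi.
rewrite flowE.
have [||g' fgc] := @conformal_pair_inj R (osquare t0 rho) (Phi 1) (fun=> e 1)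
  (@osquare_open t0 rho).
- by move=> p1 p2 _ _ /(congr1 g); rewrite !gPhi.
- by [].
rewrite /action (@Rintegral_change_of_variables R _ _ _ _ _ (fun p => L p (us p) (du us p))
   (fun t => L (Phi 1 t) (u t) z' * sqn (e 1)) fgc).
- move=> ->; apply: eq_Rintegral => t _; by rewrite du_affine_map.
- move=> _ [p /sub pt <-].
  have -> : (fun p => L p (us p) (du us p)) = (fun p => L p (us p) z') by apply/funext => p';
    rewrite dus.
  apply: lagrangian_continuous; first exact: cvg_id.
    exact: (continuous_comp (strict_cdiff_continuous (sg _)) (cu _)).
  by apply: (q_Omega s11); exact: PhiO.
- by move=> t _; rewrite dus /us gPhi.
Qed.

End AffineFlow.

(** Polar form. *)
Lemma complex_exp_onto p : p != 0 -> exists a b : R, expR a * cos b = p.1 /\ expR a * sin b = p.2.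
Proof.
move=> p0; have s0 := sqn_gt0 p0.
set r := Num.sqrt (sqn p); have r0 : 0 < r by rewrite sqrtr_gt0.
have r2 : r ^+ 2 = p.1 ^+ 2 + p.2 ^+ 2 by rewrite sqr_sqrtr// ltW.
have pr : (p.1 / r) ^+ 2 + (p.2 / r) ^+ 2 = 1.
  by rewrite !expr_div_n -mulrDl -r2 divff// lt0r_neq0// exprn_gt0.
have x1 : -1 <= p.1 / r <= 1.
  rewrite -ler_norml -(@ler_pXn2r _ 2) ?nnegrE// expr1n -normrX ger0_norm ?sqr_ge0//.
  by rewrite -pr lerDl sqr_ge0.
have ca : cos (acos (p.1 / r)) = p.1 / r by apply: acosK; rewrite in_itv.
have sa : sin (acos (p.1 / r)) = `|p.2 / r|.
  by rewrite sin_acos// -pr addrC addKr sqrtr_sqr.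
have er : expR (ln r) = r by rewrite lnK// posrE.
have rn := lt0r_neq0 r0.
(* acos only yields a nonnegative sine: the sign of the angle is that of p.2 *)
have [p2|p2] := leP 0 (p.2 / r).
- exists (ln r), (acos (p.1 / r)); rewrite er ca sa ger0_norm//.
  by split; rewrite mulrC divfK.
- exists (ln r), (- acos (p.1 / r)); rewrite er cosN sinN ca sa ltr0_norm// opprK.
  by split; rewrite mulrC divfK.
Qed.

Lemma is_derive_complex_exp (a b s : R) :
  is_derive s (1 : R) (fun s => (expR (a * s) * cos (b * s), expR (a * s) * sin (b * s)) : C)
   (cmul (a, b) (expR (a * s) * cos (b * s), expR (a * s) * sin (b * s))).
Proof.
have dE := is_derive_expRM a s.
have dc := @is_derive1_comp _ cos (fun x => b * x) s _ _ (is_derive_cos (b * s))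
  (is_derive_mull b s).
have ds := @is_derive1_comp _ sin (fun x => b * x) s _ _ (is_derive_sin (b * s))
  (is_derive_mull b s).
have D := is_derive_pair (is_deriveM dE dc) (is_deriveM dE ds).
apply: (is_derive_eq D); rewrite /cmul /GRing.scale/=; apply: pair_ext => /=; ring.
Qed.

Lemma complexify_onto (zeta : 'cV[R[i]]_n) : exists z : 'M[R]_(n, 2), complexify z = zeta.
Proof.
exists (\matrix_(j, a) if a == 0 then complex.Re (zeta j 0) else complex.Im (zeta j 0)).
apply/matrixP => j k; rewrite !mxE /= ord1.
by case: (zeta j 0).
Qed.

(** The constant field t' - t carries t to t' in unit time, along a segment in Omega. *)
Lemma invariant_translation t y z : Omega t -> exists2 r : R, 0 < r &
  forall t', `|t' - t| < r -> L t' y z = L t y z.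
Proof.
move=> Ot; have [d d0 hd] := (open_deltaP _).1 open_Omega t Ot.
exists (d / 2); first by rewrite divr_gt0.
move=> t' tt'; have d2 : 0 < d / 3 by rewrite divr_gt0.
have := @affine_flow_identity t (t' - t) 0 (fun=> (1, 0)) (fun s => t + s *: (t' - t)) (d / 3).
have c0 p : cmul 0 p = 0 by rewrite cmulC cmul0.
have one0 : ((1, 0) : C) != 0 by rewrite -sqn_eq0 /sqn/= expr1n expr0n addr0 oner_neq0.
have cinv1 : cinv ((1, 0) : C) = (1, 0).
  by rewrite /cinv /sqn/= expr1n expr0n addr0 divr1 oppr0 mul0r.
have -> : t + 1 *: (t' - t) = t' by rewrite scale1r addrC subrK.
have sq1 : sqn ((1, 0) : C) = 1 by rewrite /sqn/= expr1n expr0n addr0.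
move=> H; apply/esym; rewrite -[RHS]mul1r -{1}sq1; apply: H => //.
- by move=> s; rewrite c0; exact: is_derive_cst.
- move=> s; rewrite c0 addr0.
  by have := is_deriveD (is_derive_cst t s (1 : R)) (is_derive_scalel s (t' - t)); rewrite add0r.
- by rewrite scale0r addr0.
- move=> s /andP[s0 s1] p ps; apply: hd.
  have h : `|t + s *: (t' - t) - t| <= `|t' - t|.
    by rewrite addrC addKr normrZ ger0_norm// ler_piMl.
  rewrite (le_lt_trans (ler_distD (t + s *: (t' - t)) _ _))//.
  rewrite /csquare/= in ps; lra.
- by rewrite cinv1/= oppr0 scale1r.
Qed.

(** The field mu (p - t) fixes t; mu is chosen so that exp mu is the inverse of the
conjugate of a + b i. *)
Lemma invariant_scaling t y z z' (a b : R) : Omega t -> (a, b) != 0 :> C ->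
  complexify z' = (a +i* b)%C *: complexify z -> L t y z' = (a ^+ 2 + b ^+ 2) * L t y z.
Proof.
move=> Ot ab0 zz'; have [d d0 hd] := (open_deltaP _).1 open_Omega t Ot.
have d2 : 0 < d / 2 by rewrite divr_gt0.
have ab0' : ((a, - b) : C) != 0 by rewrite -sqn_eq0 /sqn/= sqrrN; rewrite -sqn_eq0 in ab0.
have [x [th [hx hth]]] := complex_exp_onto (cinv_neq0 ab0').
pose e s : C := (expR (x * s) * cos (th * s), expR (x * s) * sin (th * s)).
have e1 : e 1 = cinv (a, - b) by rewrite /e !mulr1 hx hth; case: (cinv _).
have := @affine_flow_identity t 0 (x, th) e (fun=> t) (d / 2).
move=> H; have {H} -> : L t y z = sqn (e 1) * L t y z'.
  apply: H => //.
  - by move=> s; exact: is_derive_complex_exp.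
  - by move=> s; rewrite subrr cmul0 addr0; exact: is_derive_cst.
  - by rewrite /e !mulr0 expR0 cos0 sin0 !mul1r.
  - by rewrite e1 cinv_neq0.
  - by move=> s _ p ps; apply: hd; rewrite /csquare/= in ps; lra.
  - by rewrite e1 cinvK//= opprK.
have s0 : sqn ((a, - b) : C) != 0 by rewrite sqn_eq0.
by rewrite e1 sqn_cinv// -[a ^+ 2 + _]/(sqn (a, b)) mulrA /sqn/= sqrrN divff ?mul1r// -(sqrrN b).
Qed.

(** The set where L agrees with its value at t, and its complement in Omega, are
both open. *)
Lemma invariant_constant t t' y z : connected Omega -> Omega t -> Omega t' -> L t' y z = L t y z.
Proof.
move=> cO Ot Ot'; pose S : set C := [set p | Omega p /\ L p y z = L t y z].
suff SE : S = Omega by have [] : S t' by rewrite SE.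
apply: cO.
- by exists t.
- exists S; last by apply/seteqP; split => p; [move=> []|move=> [_ []]].
  apply/open_deltaP => p [Op Lp]; have [r r0 hr] := invariant_translation y z Op.
  have [d d0 hd] := (open_deltaP _).1 open_Omega p Op.
  exists (Num.min r d); first by rewrite lt_min r0.
  by move=> p'; rewrite lt_min => /andP[/hr E /hd Op']; split => //; rewrite E.
- exists (~` [set p | Omega p /\ L p y z <> L t y z]).
    rewrite closedC; apply/open_deltaP => p [Op Lp]; have [r r0 hr] := invariant_translation y z Op.
    have [d d0 hd] := (open_deltaP _).1 open_Omega p Op.
    exists (Num.min r d); first by rewrite lt_min r0.
    by move=> p'; rewrite lt_min => /andP[/hr E /hd Op']; split => //; rewrite E.
  apply/seteqP; split => p /= [Op H]; split => //.
    by move=> [_].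
  by apply: contrapT => nE; apply: H.
Qed.

Lemma invariant_homogeneous : domain Omega -> exists F : 'cV[R]_n -> 'cV[R[i]]_n -> R,
    (forall t y z, Omega t -> L t y z = F y (complexify z)) /\
    (forall (lambda : R[i]) (y : 'cV[R]_n) (z : 'cV[R[i]]_n),
       F y (lambda *: z) = Normc.normc lambda ^+ 2 * F y z).
Proof.
move=> [_ [t1 Ot1] cO].
have /choice[dec hdec] := complexify_onto.
pose F y zeta := L t1 y (dec zeta).
have Fne0 (a b : R) y zeta : ((a, b) : C) != 0 -> F y ((a +i* b)%C *: zeta) = (a ^+ 2 + b ^+ 2) *
  F y zeta.
  by move=> ab; apply: invariant_scaling => //; rewrite !hdec.
exists F; split.
  move=> t y z Ot; rewrite /F -(invariant_constant y _ cO Ot Ot1).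
  by congr (L t1 y _); apply: complexify_inj; rewrite hdec.
move=> [a b] y zeta; rewrite normc_sqr.
have [ab0|ab0] := eqVneq ((a, b) : C) 0; last exact: Fne0.
case: ab0 => -> ->; rewrite expr0n/= addr0 mul0r scale0r.
(* F y 0 = 4 F y 0 *)
have two0 : ((2, 0) : C) != 0 by rewrite -sqn_eq0 /sqn/= expr0n addr0 sqrf_eq0.
have := Fne0 2 0 y 0 two0; rewrite scaler0 expr0n addr0 => H.
by move: H; set x := F y 0; lra.
Qed.

End Forward.

End Invariance.

Theorem mainTheorem1 (R : realType) (n : nat) (Omega : set (R * R)%type)
    (L : (R * R)%type -> 'cV[R]_n -> 'M[R]_(n, 2) -> R)
    (hOmega : domain Omega)
    (hL : C1_on (Omega `*` [set: 'cV[R]_n] `*` [set: 'M[R]_(n, 2)])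
                (fun p => L p.1.1 p.1.2 p.2)) :
  conformally_invariant Omega L <->
  exists F : 'cV[R]_n -> 'cV[R[i]]_n -> R,
    (forall t y z, Omega t -> L t y z = F y (complexify z)) /\
    (forall (lambda : R[i]) (y : 'cV[R]_n) (z : 'cV[R[i]]_n),
       F y (lambda *: z) = Normc.normc lambda ^+ 2 * F y z).
Proof.
have open_Omega : open Omega by case: hOmega.
split=> [hinv|[F [LF Fh]]]; first exact: (invariant_homogeneous open_Omega hL hinv hOmega).
exact: (homogeneous_invariant open_Omega hL LF Fh).
Qed.
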